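(* Let $M=G/K$ be a homogeneous Riemannian manifold with base point $o$ and let $\Sigma$ be a complete totally geodesic submanifold passing through $o$. If there exist finitely many isotropy-congruence classes at $o$ of totally geodesic submanifolds isometric to $\Sigma$, then every complete embedded totally geodesic submanifold of $M$ isometric to $\Sigma$ is extrinsically homogeneous with respect to $G$.
   Context: $G$ is a Lie group acting transitively by isometries on $M$ and $K$ is the isotropy at $o=eK$. A totally geodesic submanifold is a connected submanifold all of whose geodesics are geodesics of the ambient manifold. Two complete totally geodesic submanifolds $\Sigma_1,\Sigma_2$ passing through $o$ are isotropy-congruent at $o$ if there is $k\in K$ with $k\Sigma_1=\Sigma_2$ (equivalently $k_{*o}T_o\Sigma_1=T_o\Sigma_2$). A complete embedded totally geodesic submanifold $\Sigma'$ of $M$ is extrinsically homogeneous with respect to $G$ if $\{g\in G: g\Sigma'=\Sigma'\}$ acts transitively on $\Sigma'$. *)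

(* Defs.v *)
From HB Require Import structures.
From mathcomp Require Import all_boot all_order all_algebra.
From mathcomp Require Import all_classical all_reals all_analysis.
Import Order.TTheory GRing.Theory Num.Theory.
Import numFieldNormedType.Exports.

Set Implicit Arguments.
Unset Strict Implicit.
Unset Printing Implicit Defensive.

Local Open Scope classical_set_scope.
Local Open Scope ring_scope.

(** * Smooth maps between normed modules *)

(* [Ck] and [smooth_on] are meant for open [U]: the derivatives are those of
   the total function [f], and on an open set they only depend on the
   restriction of [f] to it. *)
Fixpoint Ck (R : realType) (k : nat) (V W : normedModType R)
    (U : set V) (f : V -> W) : Prop :=
  match k with
  | 0 => forall x, U x -> {for x, continuous f}
  | k'.+1 => (forall x, U x -> differentiable f x) /\
             (forall v, Ck k' U (fun x => 'D_v f x))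
  end.

Definition smooth_on (R : realType) (V W : normedModType R)
    (U : set V) (f : V -> W) : Prop := forall k, Ck k U f.

(** * Smooth manifolds *)

Record chart (R : realType) (T : topologicalType) (n : nat) := Chart {
  chart_dom : set T;
  chart_img : set 'rV[R]_n;
  chart_map : T -> 'rV[R]_n;
  chart_inv : 'rV[R]_n -> T;
  chart_dom_open : open chart_dom;
  chart_img_open : open chart_img;
  chart_map_img : forall x, chart_dom x -> chart_img (chart_map x);
  chart_inv_dom : forall u, chart_img u -> chart_dom (chart_inv u);
  chart_mapK : forall x, chart_dom x -> chart_inv (chart_map x) = x;
  chart_invK : forall u, chart_img u -> chart_map (chart_inv u) = u;
  chart_map_continuous :
    forall x, chart_dom x -> {for x, continuous chart_map};
  chart_inv_continuous :
    forall u, chart_img u -> {for u, continuous chart_inv} }.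

(* The coordinate expression of [f] in the charts [c] and [d]; it is only
   meaningful on [local_dom c d f]. *)
Definition local_rep (R : realType) (T T' : topologicalType) (n n' : nat)
    (c : chart R T n) (d : chart R T' n') (f : T -> T') :
    'rV[R]_n -> 'rV[R]_n' :=
  fun u => chart_map d (f (chart_inv c u)).

Definition local_dom (R : realType) (T T' : topologicalType) (n n' : nat)
    (c : chart R T n) (d : chart R T' n') (f : T -> T') : set 'rV[R]_n :=
  [set u | chart_img c u /\ chart_dom d (f (chart_inv c u))].

(* A smooth structure is presented by an atlas that need not be maximal. *)
Record smooth_structure (R : realType) (T : topologicalType) :=
  SmoothStructure {
  mdim : nat;
  atlas_index : Type;
  atlas : atlas_index -> chart R T mdim;
  atlas_cover : forall x, exists i, chart_dom (atlas i) x;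
  atlas_compatible : forall i j,
    smooth_on (local_dom (atlas i) (atlas j) id)
              (local_rep (atlas i) (atlas j) id);
  smooth_hausdorff : hausdorff_space T;
  smooth_second_countable : @second_countable T }.

Record manifold (R : realType) := Manifold {
  manifold_carrier :> topologicalType;
  manifold_structure :> smooth_structure R manifold_carrier }.

Definition smooth_map (R : realType) (M N : manifold R) (f : M -> N) : Prop :=
  continuous f /\
  forall (i : atlas_index M) (j : atlas_index N),
    smooth_on (local_dom (atlas i) (atlas j) f)
              (local_rep (atlas i) (atlas j) f).

(* Smoothness of a map defined on the product manifold [A * B], read in
   product charts. *)
Definition smooth_map2 (R : realType) (A B C : manifold R)
    (f : A -> B -> C) : Prop :=
  continuous (fun z : A * B => f z.1 z.2) /\
  forall (i : atlas_index A) (j : atlas_index B) (k : atlas_index C),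
    smooth_on
      [set z : 'rV[R]_(mdim A) * 'rV[R]_(mdim B) |
         [/\ chart_img (atlas i) z.1, chart_img (atlas j) z.2 &
             chart_dom (atlas k) (f (chart_inv (atlas i) z.1)
                                    (chart_inv (atlas j) z.2))]]
      (fun z => chart_map (atlas k) (f (chart_inv (atlas i) z.1)
                                       (chart_inv (atlas j) z.2))).

Definition immersion (R : realType) (M N : manifold R) (f : M -> N) : Prop :=
  smooth_map f /\
  forall (i : atlas_index M) (j : atlas_index N) u,
    local_dom (atlas i) (atlas j) f u ->
    injective (fun v => 'D_v (local_rep (atlas i) (atlas j) f) u).

(* [J] is meant to be open. *)
Definition smooth_curve (R : realType) (M : manifold R) (J : set R)
    (c : R -> M) : Prop :=
  (forall t, J t -> {for t, continuous c}) /\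
  forall i : atlas_index M,
    smooth_on (J `&` c @^-1` chart_dom (atlas i))
              (chart_map (atlas i) \o c).

(** * Riemannian manifolds *)

Definition inner (R : realType) (n : nat) (A : 'M[R]_n) (v w : 'rV[R]_n) : R :=
  (v *m A *m w^T) 0 0.

(* A field of bilinear forms on a manifold, given by its Gram matrix in the
   coordinates of each chart. *)
Definition gram_field (R : realType) (M : manifold R) :=
  atlas_index M -> 'rV[R]_(mdim M) -> 'M[R]_(mdim M).

(* [gM = f^* gN], i.e. gM_u(v, w) = gN_{f u}(df_u v, df_u w) in all charts. *)
Definition is_pullback (R : realType) (M N : manifold R)
    (gM : gram_field M) (gN : gram_field N) (f : M -> N) : Prop :=
  forall (i : atlas_index M) (j : atlas_index N) u,
    local_dom (atlas i) (atlas j) f u ->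
    forall v w,
      inner (gM i u) v w =
      inner (gN j (local_rep (atlas i) (atlas j) f u))
            ('D_v (local_rep (atlas i) (atlas j) f) u)
            ('D_w (local_rep (atlas i) (atlas j) f) u).

(* [metric_change] is the tensorial transformation law under change of
   charts. *)
Record riemannian_manifold (R : realType) := RiemannianManifold {
  riemannian_carrier :> manifold R;
  metric : gram_field riemannian_carrier;
  metric_smooth : forall i, smooth_on (chart_img (atlas i)) (metric i);
  metric_sym : forall i u, chart_img (atlas i) u ->
    (metric i u)^T = metric i u;
  metric_pos : forall i u, chart_img (atlas i) u ->
    forall v, v != 0 -> 0 < inner (metric i u) v v;
  metric_change : is_pullback metric metric id }.

Definition isometry (R : realType) (M N : riemannian_manifold R)
    (f : M -> N) : Prop :=
  [/\ smooth_map f,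
      (exists f', [/\ smooth_map f', cancel f f' & cancel f' f]) &
      is_pullback (@metric R M) (@metric R N) f].

Definition isometric (R : realType) (M N : riemannian_manifold R) : Prop :=
  exists f : M -> N, isometry f.

(* Gamma^k_{ab} = 1/2 g^{kl} (d_a g_{bl} + d_b g_{al} - d_l g_{ab}) *)
Definition christoffel (R : realType) (n : nat) (g : 'rV[R]_n -> 'M[R]_n)
    (u : 'rV[R]_n) (k a b : 'I_n) : R :=
  let d (c p q : 'I_n) : R := 'D_(delta_mx 0 c) (fun y => g y p q) u in
  2^-1 * \sum_l invmx (g u) k l * (d a b l + d b a l - d l a b).

(* The geodesic equation x''^k + Gamma^k_{ab}(x) x'^a x'^b = 0 in charts. *)
Definition geodesic_on (R : realType) (M : riemannian_manifold R)
    (J : set R) (c : R -> M) : Prop :=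
  smooth_curve J c /\
  forall (i : atlas_index M) t, J t -> chart_dom (atlas i) (c t) ->
    let x := chart_map (atlas i) \o c in
    forall k : 'I_(mdim M),
      (derive1n 2 x t) 0 k +
      \sum_a \sum_b christoffel (metric i) (x t) k a b
                    * (derive1 x t) 0 a * (derive1 x t) 0 b = 0.

Definition open_interval (R : realType) (J : set R) : Prop :=
  open J /\ is_interval J.

Definition complete_riemannian (R : realType) (M : riemannian_manifold R) :
    Prop :=
  forall (J : set R) (c : R -> M), open_interval J -> geodesic_on J c ->
  exists c' : R -> M, geodesic_on setT c' /\ (forall t, J t -> c' t = c t).

(** * Submanifolds *)

(* An immersed submanifold: a manifold with an injective immersion, carrying
   the induced metric. *)
Record submanifold (R : realType) (M : riemannian_manifold R) := Submanifold {
  sub_manifold :> riemannian_manifold R;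
  sub_incl : sub_manifold -> M;
  sub_incl_inj : injective sub_incl;
  sub_incl_immersion : immersion sub_incl;
  sub_induced_metric :
    is_pullback (@metric R sub_manifold) (@metric R M) sub_incl }.

Definition sub_points (R : realType) (M : riemannian_manifold R)
  (S : submanifold M) : set M := range (@sub_incl R M S).

Definition embedded (R : realType) (M : riemannian_manifold R)
    (S : submanifold M) : Prop :=
  forall U : set S, open U ->
  exists2 V : set M, open V &
    @sub_incl R M S @` U = V `&` sub_points S.

Definition totally_geodesic (R : realType) (M : riemannian_manifold R)
    (S : submanifold M) : Prop :=
  connected [set: S] /\
  forall (J : set R) (c : R -> S), open_interval J ->
    geodesic_on J c -> geodesic_on J (@sub_incl R M S \o c).

(** * Lie groups and isometric actions *)

(* No compatibility between the two structures is required here: continuity of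
   the operations is part of [lie_mul_smooth] and [lie_inv_smooth]. *)
#[short(type="groupTopologicalType")]
HB.structure Definition GroupTopological := {G of Group G & Topological G}.

Record lie_group (R : realType) := LieGroup {
  lie_carrier :> groupTopologicalType;
  lie_structure : smooth_structure R lie_carrier;
  lie_manifold := Manifold lie_structure;
  lie_mul_smooth :
    @smooth_map2 R lie_manifold lie_manifold lie_manifold
      (fun x y => (x * y)%g);
  lie_inv_smooth :
    @smooth_map R lie_manifold lie_manifold (fun x => (x^-1)%g) }.

Record isometric_action (R : realType) (G : lie_group R)
    (M : riemannian_manifold R) := IsometricAction {
  act :> G -> M -> M;
  act1 : forall x, act 1%g x = x;
  actM : forall g h x, act (g * h)%g x = act g (act h x);
  act_smooth : @smooth_map2 R (lie_manifold G) M M act;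
  act_isometry : forall g, isometry (act g) }.

Section Congruence.
Context (R : realType) (G : lie_group R) (M : riemannian_manifold R).
Implicit Types (a : isometric_action G M) (o : M) (S : submanifold M).

Definition transitive_action a : Prop := forall x y, exists g, a g x = y.

Definition isotropy a o : set G := [set k | a k o = o].

(* Congruence of submanifolds only involves their point sets, so it is stated
   for subsets of [M]. *)
Definition isotropy_congruent a o (A B : set M) : Prop :=
  exists2 k, isotropy a o k & a k @` A = B.

(* The point sets of the complete totally geodesic submanifolds through [o]
   isometric to [S]. *)
Definition geodesic_submanifolds_at o S : set (set M) :=
  [set A | exists S1 : submanifold M,
     [/\ complete_riemannian S1, totally_geodesic S1, isometric S1 S,
         sub_points S1 = A & A o]].

Definition isotropy_congruence_classes a o S : set (set (set M)) :=
  [set [set B | geodesic_submanifolds_at o S B /\ isotropy_congruent a o A B]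
     | A in geodesic_submanifolds_at o S].

Definition extrinsically_homogeneous a S : Prop :=
  forall x y, sub_points S x -> sub_points S y ->
  exists2 g, a g @` sub_points S = sub_points S & a g x = y.

End Congruence.

(* Main.v *)
Require Import Defs.
From HB Require Import structures.
From mathcomp Require Import all_boot all_order all_algebra.
From mathcomp Require Import all_classical all_reals all_analysis.
From mathcomp Require Import ring lra.

(** Write [H] for the stabilizer in [G] of the point set of [S']. The theorem says
    that [H] is transitive on [S'].

    Finitely many orbits. Given two points [s] and [t] of [S'], move each of them
    to [o] by elements [g] and [h] of [G]. The translates of [S'] by [g] and [h]
    are complete totally geodesic submanifolds through [o] isometric to [S]. If
    they are congruent under [k] in the isotropy group, then [h^-1 * k * g] lies
    in [H] and carries [s] to [t] ([congruent_same_orbit]). So [S'] is a union of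
    at most as many orbits of [H] as there are congruence classes. What has to be
    known here is that isometries preserve geodesics ([geodesic_comp]); this is
    proved by writing the geodesic equation as the Euler-Lagrange equation of the
    energy, whose transformation law only needs the chain rule and the symmetry
    of second derivatives ([euler_lagrange_pullback]).

    One orbit is open. An embedded submanifold is locally closed
    ([embedded_frontier_closed]), so [H], which preserves the two closed sets
    [closure S'] and [closure S' `\` S'], is closed in [G]
    ([stabilizer_closed]). Since [G] is sigma-compact, [S'] is a countable union
    of closed pieces of orbits, and Baire's theorem provides an orbit with
    interior ([orbit_with_interior]), which is open by homogeneity.

    An open orbit is closed. This is where [H] acts by isometries: a family of
    maps preserving the metric is equicontinuous ([isometric_equicontinuity]),
    so if [h p] is close to [q], then [h^-1 q] is close to [p] and lies in the
    orbit ([open_orbit_closed]). Equicontinuity is obtained directly from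
    coordinate segments and the mean value theorem, so neither the Riemannian
    distance nor the exponential map is used, and no differential equation is
    solved. Closedness of the orbits cannot be deduced from properness of the
    action, because the isotropy group need not be compact.

    An open and closed orbit is all of the connected manifold [S']. *)

Import Order.TTheory GRing.Theory Num.Theory.
Import numFieldNormedType.Exports.

Set Implicit Arguments.
Unset Strict Implicit.
Unset Printing Implicit Defensive.

Local Open Scope classical_set_scope.
Local Open Scope ring_scope.

(** * Calculus of C^k maps *)

Section Calculus.
Context (R : realType).
Implicit Types (U V W : normedModType R).

Lemma near_eq_differentiable V W (f g : V -> W) (x : V) :
  {near x, f =1 g} -> differentiable f x -> differentiable g x.
Proof.
move=> fg /diff_locallyP[dfc dfe].
have gfx : g x = f x by rewrite (nbhs_singleton fg).
have dge : g \o shift x = cst (g x) + 'd f x +o_ 0 id.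
  apply/eqaddoP => e e0.
  move/eqaddoP: dfe => /(_ e e0) dfe.
  have fg0 : \forall h \near 0, f (h + x) = g (h + x).
    by move: fg; rewrite (near_shift 0); apply: filterS => h /=; rewrite subr0.
  near=> h.
  have -> : (g \o shift x - (cst (g x) + 'd f x)) h =
            (f \o shift x - (cst (f x) + 'd f x)) h.
    by rewrite !fctE /= gfx; congr (_ - _); apply/esym; near: h.
  by near: h.
apply/diff_locallyP.
have -> : ('d g x : V -> W) = 'd f x by apply: diff_unique.
by [].
Unshelve. all: by end_near. Qed.

(** The recursion in [Ck] only ever quantifies over the points of the set, so a
    C^k condition can be checked point by point. Locality of smoothness rests on
    this. *)
Lemma Ck_mem k V W (A : set V) (f : V -> W) :
  Ck k A f <-> forall x, A x -> Ck k [set x] f.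
Proof.
elim: k A f => [|k IH] A f /=.
  by split=> [H x Ax _ -> | H x Ax]; [exact: H | exact: (H x)].
split=> [[H1 H2] x Ax | H].
  by split=> [_ ->|v]; [exact: H1 | move/IH: (H2 v); apply].
split=> [x Ax|v]; first by have [+ _] := H x Ax; apply.
by apply/IH => x Ax; have [_ +] := H x Ax; apply.
Qed.

Lemma Ck_sub k V W (A B : set V) (f : V -> W) :
  A `<=` B -> Ck k B f -> Ck k A f.
Proof. by move=> AB /Ck_mem H; apply/Ck_mem => x /AB; exact: H. Qed.

Lemma Ck_near_eq k V W (A : set V) (f g : V -> W) :
  (forall x, A x -> {near x, f =1 g}) -> Ck k A f -> Ck k A g.
Proof.
elim: k A f g => [|k IH] A f g fg /=.
  move=> H x Ax; have /= Hx : f @ x --> f x := H x Ax.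
  rewrite /prop_for /continuous_at -[g x](nbhs_singleton (fg x Ax)).
  by apply: cvg_trans Hx; apply: near_eq_cvg; exact: fg.
move=> [H1 H2]; split=> [x Ax|v].
  by apply: near_eq_differentiable (H1 x Ax); exact: fg.
apply: IH (H2 v) => x Ax.
have /nbhs_interior := fg x Ax.
by apply: filterS => y fgy; apply: near_eq_derive.
Qed.

Lemma smooth_on_local V W (A : set V) (f : V -> W) :
  (forall x, A x -> exists g (B : set V),
     [/\ B x, smooth_on B g & {near x, g =1 f}]) ->
  smooth_on A f.
Proof.
move=> H k; apply/Ck_mem => x /H[g [B [Bx Bg gf]]].
apply: (@Ck_near_eq _ _ _ _ g); first by move=> _ ->.
by apply: Ck_sub (Bg k) => _ ->.
Qed.

Lemma smooth_on_sub V W (A B : set V) (f : V -> W) :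
  A `<=` B -> smooth_on B f -> smooth_on A f.
Proof. by move=> AB fB k; apply: Ck_sub (fB k). Qed.

Lemma smooth_on_differentiable V W (A : set V) (f : V -> W) x :
  smooth_on A f -> A x -> differentiable f x.
Proof. by move=> /(_ 1%N)[H _]; exact: H. Qed.

Lemma smooth_on_derive V W (A : set V) (f : V -> W) v :
  smooth_on A f -> smooth_on A ('D_v f).
Proof. by move=> H k; have [_] := H k.+1; apply. Qed.

Lemma smooth_on_continuous V W (A : set V) (f : V -> W) x :
  smooth_on A f -> A x -> {for x, continuous f}.
Proof. by move=> fA Ax; apply: (fA 0%N). Qed.

Lemma Ck_pred k V W (A : set V) (f : V -> W) : Ck k.+1 A f -> Ck k A f.
Proof.
elim: k f => [|k IH] f [H1 H2].
  by move=> x Ax; apply: differentiable_continuous; exact: H1.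
by split=> // v; apply: IH; exact: H2.
Qed.

Lemma Ck_cst k V W (A : set V) (c : W) : Ck k A (fun=> c : W).
Proof.
elim: k c => [|k IH] c /=; first by move=> x _; apply: cst_continuous.
split=> [x _|v]; first exact: differentiable_cst.
have -> : 'D_v (fun=> c) = (fun=> 0 : W) by apply/funext => x; exact: derive_cst.
exact: IH.
Qed.

Lemma CkD k V W (A : set V) (f g : V -> W) : open A ->
  Ck k A f -> Ck k A g -> Ck k A (fun x => f x + g x).
Proof.
move=> Ao; elim: k f g => [|k IH] f g.
  by move=> H1 H2 x Ax; apply: continuousD; [exact: H1|exact: H2].
move=> [f1 f2] [g1 g2]; split=> [x Ax|v].
  by apply: differentiableD; [exact: f1|exact: g1].
apply: (@Ck_near_eq _ _ _ _ (fun x => 'D_v f x + 'D_v g x)); last first.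
  by apply: IH; [exact: f2|exact: g2].
move=> x Ax; have := open_nbhs_nbhs (conj Ao Ax); apply: filterS => y Ay.
by rewrite deriveD //; apply/diff_derivable; [exact: f1|exact: g1].
Qed.

Lemma Ck_sum k V W (A : set V) n (f : 'I_n -> V -> W) : open A ->
  (forall i, Ck k A (f i)) -> Ck k A (fun x => \sum_i f i x).
Proof.
move=> Ao fA.
elim: n f fA => [|n IH] f fA.
  have -> : (fun x => \sum_i f i x) = (fun=> 0).
    by apply/funext => x; rewrite big_ord0.
  exact: Ck_cst.
have -> : (fun x => \sum_i f i x) =
          (fun x => f ord0 x + \sum_(i < n) f (lift ord0 i) x).
  by apply/funext => x; rewrite big_ord_recl.
by apply: CkD => //; apply: IH => i.
Qed.

Lemma scale_bilinear W : bilinear_for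
    (GRing.Scale.Law.clone _ _ *:%R _) (GRing.Scale.Law.clone _ _ *:%R _)
    (fun (r : R^o) (w : W) => r *: w).
Proof.
split=> [w|r] a x y /=; first by rewrite scalerDl scalerA.
by rewrite scalerDr !scalerA mulrC.
Qed.

Lemma is_diff_scale V W (r : V -> R) (f : V -> W) x :
  differentiable r x -> differentiable f x ->
  is_diff x (fun y => r y *: f y) (fun h => r x *: 'd f x h + 'd r x h *: f x).
Proof.
move=> dr df.
pose bM := bilinear_isBilinear.Build R R^o W W _ _ _ (scale_bilinear W).
pose b : {bilinear R^o -> W -> W} := HB.pack (fun (r : R^o) (w : W) => r *: w) bM.
have bc : continuous (fun p : R^o * W => b p.1 p.2) by exact: scale_continuous.
have -> : (fun y => r y *: f y) =
    (fun p : R^o * W => b p.1 p.2) \o (fun y => (r y : R^o, f y)) by [].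
have db := differentiable_bilin (r x : R^o, f x) bc.
have dp := @differentiable_pair _ _ R^o _ _ _ _ dr df.
apply: DiffDef; first exact: differentiable_comp.
by rewrite diff_comp // diff_bilin // diff_pair.
Qed.

Lemma derive_scale V W (r : V -> R) (f : V -> W) x v :
  differentiable r x -> differentiable f x ->
  'D_v (fun y => r y *: f y) x = 'D_v r x *: f x + r x *: 'D_v f x.
Proof.
move=> dr df; have [d1 d2] := is_diff_scale dr df.
by rewrite (deriveE v d1) d2 addrC (deriveE v dr) (deriveE v df).
Qed.

Lemma CkZ k V W (A : set V) (r : V -> R) (f : V -> W) : open A ->
  Ck k A r -> Ck k A f -> Ck k A (fun x => r x *: f x).
Proof.
move=> Ao; elim: k r f => [|k IH] r f.
  by move=> H1 H2 x Ax; apply: cvgZ; [exact: H1|exact: H2].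
move=> [r1 r2] [f1 f2]; split=> [x Ax|v].
  by have [] := is_diff_scale (r1 x Ax) (f1 x Ax).
apply: (@Ck_near_eq _ _ _ _ (fun x => r x *: 'D_v f x + 'D_v r x *: f x));
  last first.
  by apply: CkD => //; apply: IH; [|exact: f2|exact: r2|]; apply: Ck_pred.
move=> x Ax; have := open_nbhs_nbhs (conj Ao Ax); apply: filterS => y Ay.
have [d1 d2] := is_diff_scale (r1 y Ay) (f1 y Ay).
by rewrite (deriveE v d1) d2 !deriveE//; [exact: r1|exact: f1].
Qed.

Lemma derive_coord V m n (f : V -> 'M[R]_(m, n)) x v i j :
  differentiable f x -> 'D_v (fun y => f y i j) x = 'D_v f x i j.
Proof. by move=> df; rewrite derive_mx ?mxE//; exact: diff_derivable. Qed.

Lemma differentiable_entry V m n (f : V -> 'M[R]_(m, n)) x i j :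
  differentiable f x -> differentiable (fun y => f y i j) x.
Proof.
move=> df; have -> : (fun y => f y i j) = (fun A : 'M[R]_(m, n) => A i j) \o f by [].
by apply: differentiable_comp => //; exact: differentiable_coord.
Qed.

Lemma Ck_coord k V m n (A : set V) (f : V -> 'M[R]_(m, n)) i j : open A ->
  Ck k A f -> Ck k A (fun x => f x i j).
Proof.
move=> Ao; elim: k f => [|k IH] f.
  move=> H x Ax.
  apply: (@continuous_comp _ _ _ f (fun M : 'M[R]_(m, n) => M i j)).
    exact: H.
  exact: coord_continuous.
move=> [f1 f2]; split=> [x Ax|v].
  by apply: differentiable_entry; exact: f1.
apply: (@Ck_near_eq _ _ _ _ (fun x => 'D_v f x i j)); last exact: IH (f2 v).
move=> x Ax; have := open_nbhs_nbhs (conj Ao Ax); apply: filterS => y Ay.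
by apply/esym/derive_coord; exact: f1.
Qed.

Lemma derive_basis n W (f : 'rV[R]_n -> W) x v : differentiable f x ->
  'D_v f x = \sum_j v 0 j *: 'D_(delta_mx 0 j) f x.
Proof.
move=> df; rewrite deriveE // {1}(row_sum_delta v) linear_sum.
by apply: eq_bigr => j _; rewrite linearZ /= deriveE.
Qed.

Lemma derive_comp U V W (f : U -> V) (g : V -> W) x v :
  differentiable f x -> differentiable g (f x) ->
  'D_v (g \o f) x = 'D_('D_v f x) g (f x).
Proof.
move=> df dg; rewrite [LHS]deriveE; last exact: differentiable_comp.
by rewrite diff_comp //= !deriveE.
Qed.

(** The chain rule expresses a directional derivative of [g \o f] as a sum, over
    the coordinates, of products of derivatives of [f] and partial derivatives
    of [g] at [f x]. The induction on [k] therefore closes up once sums, scalar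
    products and coordinates of C^k maps are C^k. *)
Lemma Ck_comp k V n W (A : set V) (B : set 'rV[R]_n) (f : V -> 'rV[R]_n)
    (g : 'rV[R]_n -> W) : open A -> (forall x, A x -> B (f x)) ->
  Ck k A f -> Ck k B g -> Ck k A (g \o f).
Proof.
move=> Ao AB; elim: k f g AB => [|k IH] f g AB.
  by move=> H1 H2 x Ax; apply: continuous_comp; [exact: H1|exact: H2 (AB _ Ax)].
move=> Hf Hg; have fk := Ck_pred Hf.
move: Hf Hg => [f1 f2] [g1 g2]; split=> [x Ax|v].
  by apply: differentiable_comp; [exact: f1|exact: g1 (AB _ Ax)].
apply: (@Ck_near_eq _ _ _ _
  (fun x => \sum_j ('D_v f x) 0 j *: ('D_(delta_mx 0 j) g \o f) x)); last first.
  apply: Ck_sum => // j; apply: CkZ => //; first exact: Ck_coord (f2 v).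
  exact: IH (g2 _).
move=> x Ax; have := open_nbhs_nbhs (conj Ao Ax); apply: filterS => y Ay.
have df := f1 y Ay; have dg := g1 _ (AB _ Ay).
by rewrite [RHS](derive_comp v df dg) (derive_basis ('D_v f y) dg).
Qed.

Lemma smooth_on_comp V n W (A : set V) (B : set 'rV[R]_n) (f : V -> 'rV[R]_n)
    (g : 'rV[R]_n -> W) : open A -> (forall x, A x -> B (f x)) ->
  smooth_on A f -> smooth_on B g -> smooth_on A (g \o f).
Proof. by move=> Ao AB fA gB k; apply: Ck_comp (fA k) (gB k). Qed.

End Calculus.

(** * Symmetry of second derivatives *)

Section SecondDerivatives.
Context (R : realType).
Implicit Types (V W : normedModType R).

Lemma is_derive_line V W (f : V -> W) (y v : V) (s : R) :
  differentiable f (y + s *: v) ->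
  is_derive s 1 (fun t : R => f (y + t *: v)) ('D_v f (y + s *: v)).
Proof.
move=> df.
have dl : is_diff s (fun t : R => y + t *: v) (fun t : R => t *: v).
  have := is_diffD (is_diff_cst y s) (is_diff_scalel s v).
  by rewrite add0r.
have dfl : differentiable (f \o (fun t : R => y + t *: v)) s.
  by apply: differentiable_comp.
apply: DeriveDef; first exact: diff_derivable.
rewrite (@derive_comp _ _ _ _ (fun t : R => y + t *: v) f s) //.
have -> : 'D_1 (fun t : R => y + t *: v) s = v.
  by rewrite deriveE // diff_val scale1r.
by [].
Qed.

Lemma MVT_line V (f : V -> R) (y v : V) (h : R) : 0 < h ->
  (forall s : R, 0 <= s <= h -> differentiable f (y + s *: v)) ->
  exists2 s : R, 0 < s < h & f (y + h *: v) - f y = h * 'D_v f (y + s *: v).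
Proof.
move=> h0 df.
have := @MVT R (fun t => f (y + t *: v)) (fun t => 'D_v f (y + t *: v)) 0 h h0.
case.
- move=> s; rewrite in_itv /= => /andP[s0 sh]; apply: is_derive_line.
  by apply: df; rewrite !ltW.
- apply: derivable_within_continuous => s; rewrite in_itv /= => sh.
  by have [] := is_derive_line (df s sh).
- move=> s; rewrite in_itv /= => sh; rewrite scale0r addr0 subr0 mulrC => ->.
  by exists s.
Qed.

(** Applying the mean value theorem along [v] to the increment of [f] in the
    direction [w], then along [w] to ['D_v f], turns the second difference into
    [h ^+ 2] times a value of ['D_w ('D_v f)] near [x]. The second difference is
    symmetric in [v] and [w] while the limit is not visibly so. *)
Lemma second_difference V (A : set V) (f : V -> R) (x v w : V) (e : R) :
  open A -> smooth_on A f -> A x -> 0 < e ->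
  exists2 d, 0 < d & forall h, 0 < h < d ->
    `|f (x + h *: w + h *: v) - f (x + h *: w) - (f (x + h *: v) - f x)
      - h ^+ 2 * 'D_w ('D_v f) x| <= e * h ^+ 2.
Proof.
move=> Ao fA Ax e0.
have fv : smooth_on A ('D_v f) by exact: smooth_on_derive.
have cD : {for x, continuous ('D_w ('D_v f))}.
  by apply: smooth_on_continuous Ax; exact: smooth_on_derive.
have : \forall y \near x, A y /\ `|'D_w ('D_v f) x - 'D_w ('D_v f) y| < e.
  near=> y; split; first by near: y; exact: open_nbhs_nbhs.
  by near: y; move/cvgrPdist_lt: cD; apply.
move=> /nbhs_ballP[r /= r0 xr].
have d0 : 0 < `|v| + `|w| + 1 by rewrite ltr_wpDl // addr_ge0.
exists (r / (`|v| + `|w| + 1)); first exact: divr_gt0.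
move=> h /andP[h0]; rewrite ltr_pdivlMr // => hr.
have near_x (s t : R) : 0 <= s <= h -> 0 <= t <= h ->
    A (x + t *: w + s *: v) /\
    `|'D_w ('D_v f) x - 'D_w ('D_v f) (x + t *: w + s *: v)| < e.
  move=> /andP[s0 sh] /andP[t0 th]; apply: xr.
  rewrite -ball_normE /ball_ /= -addrA opprD addrA subrr add0r normrN.
  apply: le_lt_trans (ler_normD _ _) _; rewrite !normrZ !ger0_norm //.
  apply: le_lt_trans hr; rewrite mulrDr mulrDr mulr1.
  have := ler_wpM2r (normr_ge0 v) sh; have := ler_wpM2r (normr_ge0 w) th.
  by move=> *; rewrite -[leLHS]addr0 lerD ?(ltW h0)// addrC lerD.
have [|s /andP[s0 sh] Es] := @MVT_line _
  (fun y => f (y + h *: w) - f y) x v h h0.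
  move=> s sh; apply: differentiableB; last first.
    apply: (smooth_on_differentiable fA).
    by have [] := near_x s 0 sh; rewrite ?lexx ?ltW // scale0r addr0.
  apply: (@differentiable_comp _ _ _ _ (fun y => y + h *: w) f) => //.
  apply: (smooth_on_differentiable fA); rewrite addrAC.
  by have [] := near_x s h sh; rewrite ?lexx ?ltW.
rewrite /= in Es.
have Ash : 0 <= s <= h by rewrite !ltW.
have A1 : A (x + s *: v + h *: w).
  by rewrite addrAC; have [] := near_x s h Ash; rewrite ?lexx ?ltW.
have A0 : A (x + s *: v).
  by have [] := near_x s 0 Ash; rewrite ?lexx ?ltW // scale0r addr0.
have Eb : 'D_v (fun y => f (y + h *: w) - f y) (x + s *: v) =
          'D_v f (x + s *: v + h *: w) - 'D_v f (x + s *: v).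
  have d1 : differentiable (fun y => y + h *: w) (x + s *: v).
    by apply: differentiableD.
  have d2 := smooth_on_differentiable fA A1.
  rewrite (@deriveB _ _ _ (f \o (fun y => y + h *: w)) f).
  - rewrite derive_comp // deriveD ?derive_id ?derive_cst ?addr0 //.
  - by apply: diff_derivable; apply: differentiable_comp.
  - by apply: diff_derivable; exact: smooth_on_differentiable fA A0.
have [|t /andP[t0 th] Et] := @MVT_line _ ('D_v f) (x + s *: v) w h h0.
  move=> t th; apply: (smooth_on_differentiable fv); rewrite addrAC.
  by have [] := near_x s t Ash th.
rewrite Eb Et in Es.
have -> : f (x + h *: w + h *: v) - f (x + h *: w) - (f (x + h *: v) - f x) =
   h * (h * 'D_w ('D_v f) (x + s *: v + t *: w)).
  by rewrite -Es [x + h *: v + _]addrAC; ring.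
have Ath : 0 <= t <= h by rewrite !ltW.
have [_] := near_x s t Ash Ath; rewrite [x + t *: w + _]addrAC => lt.
rewrite mulrA -expr2 -mulrBr normrM ger0_norm ?sqr_ge0 // mulrC.
by apply: ler_wpM2r; [exact: sqr_ge0|rewrite distrC; exact: ltW].
Unshelve. all: by end_near. Qed.

Lemma derive_swap_real V (A : set V) (f : V -> R) (x v w : V) :
  open A -> smooth_on A f -> A x -> 'D_v ('D_w f) x = 'D_w ('D_v f) x.
Proof.
move=> Ao fA Ax; apply/eqP; rewrite -subr_eq0 -normr_le0.
apply/ler_addgt0Pl => e e0; rewrite addr0.
have e2 : 0 < e / 2 by rewrite divr_gt0.
have [d1 d10 H1] := second_difference v w Ao fA Ax e2.
have [d2 d20 H2] := second_difference w v Ao fA Ax e2.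
(* any step below both thresholds would do *)
pose h := Num.min d1 d2 / 2.
have m0 : 0 < Num.min d1 d2 by rewrite lt_min d10.
have h0 : 0 < h by rewrite divr_gt0.
have hm : h < Num.min d1 d2 by rewrite ltr_pdivrMr // ltr_pMr // ltr1n.
have {}H1 := H1 h; rewrite h0 (lt_le_trans hm) ?ge_min ?lexx // in H1.
have {}H2 := H2 h; rewrite h0 (lt_le_trans hm) ?ge_min ?lexx ?orbT // in H2.
have {}H1 := H1 isT; have {}H2 := H2 isT.
have hh : 0 < h ^+ 2 by rewrite exprn_gt0.
rewrite -(ler_pM2r hh) -[X in _ * X](ger0_norm (ltW hh)) -normrM.
set a := 'D_v _ _ in H1 H2 *; set b := 'D_w _ _ in H1 H2 *.
have -> : (a - b) * h ^+ 2 =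
  (f (x + h *: w + h *: v) - f (x + h *: w) - (f (x + h *: v) - f x)
      - h ^+ 2 * b) -
  (f (x + h *: v + h *: w) - f (x + h *: v) - (f (x + h *: w) - f x)
      - h ^+ 2 * a).
  by rewrite [x + h *: v + _]addrAC; ring.
apply: le_trans (ler_normB _ _) _; apply: le_trans (lerD H1 H2) _.
by rewrite -mulrDl -splitr.
Qed.

Lemma derive_swap V m n (A : set V) (f : V -> 'M[R]_(m, n)) (x v w : V) :
  open A -> smooth_on A f -> A x -> 'D_v ('D_w f) x = 'D_w ('D_v f) x.
Proof.
move=> Ao fA Ax; apply/matrixP => i j.
have E (a b : V) : 'D_a ('D_b f) x i j = 'D_a ('D_b (fun y => f y i j)) x.
  rewrite -derive_coord; last first.
    by apply: smooth_on_differentiable Ax; exact: smooth_on_derive.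
  apply: near_eq_derive; have := open_nbhs_nbhs (conj Ao Ax).
  apply: filterS => y Ay; rewrite derive_coord //.
  exact: smooth_on_differentiable fA Ay.
have fij : smooth_on A (fun y => f y i j) by move=> k; exact: Ck_coord (fA k).
apply: etrans (E v w) _; apply: etrans (esym (E w v)).
exact: derive_swap_real Ao fij Ax.
Qed.

End SecondDerivatives.

(** * The geodesic equation in Euler-Lagrange form *)

Section EulerLagrange.
Context (R : realType).
Implicit Types (V : normedModType R).

Lemma innerE n (A : 'M[R]_n) v w :
  inner A v w = \sum_i \sum_j v 0 i * A i j * w 0 j.
Proof.
rewrite /inner mxE exchange_big /=; apply: eq_bigr => j _.
by rewrite !mxE mulr_suml.
Qed.

Lemma innerDl n (A : 'M[R]_n) v v' w :
  inner A (v + v') w = inner A v w + inner A v' w.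
Proof. by rewrite /inner !mulmxDl mxE. Qed.

Lemma inner_symm n (A : 'M[R]_n) v w : A^T = A -> inner A v w = inner A w v.
Proof.
move=> As; have E : (w *m A *m v^T)^T = v *m A *m w^T.
  by rewrite !trmx_mul trmxK As mulmxA.
by rewrite /inner -E mxE.
Qed.

Lemma is_derive_inner V n (A : V -> 'M[R]_n) (p q : V -> 'rV[R]_n) x z :
  differentiable A x -> differentiable p x -> differentiable q x ->
  is_derive x z (fun y => inner (A y) (p y) (q y))
    (inner ('D_z A x) (p x) (q x) + inner (A x) ('D_z p x) (q x) +
     inner (A x) (p x) ('D_z q x)).
Proof.
move=> dA dp dq.
have coordP m k (M : V -> 'M[R]_(m, k)) i j : differentiable M x ->
    is_derive x z (fun y => M y i j) ('D_z M x i j).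
  move=> dM; rewrite -derive_coord //; apply: derivableP.
  by apply: diff_derivable; exact: differentiable_entry.
have -> : (fun y => inner (A y) (p y) (q y)) =
    \sum_i \sum_j ((fun y => p y 0 i) * (fun y => A y i j) * (fun y => q y 0 j)).
  apply/funext => y; rewrite innerE fct_sumE; apply: eq_bigr => i _.
  by rewrite fct_sumE.
apply: (@is_derive_eq _ _ _ _ _ _ _ _
  (is_derive_sum (fun i => is_derive_sum (fun j =>
     is_deriveM (is_deriveM (coordP _ _ p 0 i dp) (coordP _ _ A i j dA))
                (coordP _ _ q 0 j dq))))).
rewrite !innerE -!big_split /=; apply: eq_bigr => i _.
rewrite -!big_split /=; apply: eq_bigr => j _.
change (p x 0 i * A x i j * 'D_z q x 0 j + q x 0 j *
  (p x 0 i * 'D_z A x i j + A x i j * 'D_z p x 0 i) =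
  p x 0 i * 'D_z A x i j * q x 0 j + 'D_z p x 0 i * A x i j * q x 0 j +
  p x 0 i * A x i j * 'D_z q x 0 j).
by ring.
Qed.

Lemma factor_sum3 n (c : 'I_n -> R) (F : 'I_n -> 'I_n -> 'I_n -> R) :
  \sum_i \sum_j \sum_l c l * F i j l = \sum_l c l * \sum_i \sum_j F i j l.
Proof.
under eq_bigr do rewrite exchange_big /=.
rewrite exchange_big /=; apply: eq_bigr => l _.
by rewrite mulr_sumr; apply: eq_bigr => i _; rewrite mulr_sumr.
Qed.

(** The Euler-Lagrange expression of the energy [inner (g x) x' x' / 2], tested
    against [w], at position [u] with velocity [v] and acceleration [a]. It
    involves neither the inverse of the metric nor coordinates, which makes its
    behaviour under changes of variables transparent. *)
Definition euler_lagrange n (g : 'rV[R]_n -> 'M[R]_n) (u v a w : 'rV[R]_n) : R :=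
  inner (g u) a w + inner ('D_v g u) v w - 2^-1 * inner ('D_w g u) v v.

(** The Euler-Lagrange expression is the geodesic equation with its index lowered
    by [g u], and [g u] is invertible. Only the part of the derivatives of [g]
    that is symmetric in the two velocity slots contributes to it. *)
Lemma christoffel_euler_lagrange n (g : 'rV[R]_n -> 'M[R]_n)
    (u v a : 'rV[R]_n) :
  differentiable g u -> (g u)^T = g u -> g u \in unitmx ->
  (forall k, a 0 k +
     \sum_i \sum_j christoffel g u k i j * v 0 i * v 0 j = 0) <->
  (forall w, euler_lagrange g u v a w = 0).
Proof.
move=> dg gs gu.
pose d (c p q : 'I_n) : R := 'D_(delta_mx 0 c) g u p q.
pose L : 'rV[R]_n := \row_l \sum_i \sum_j
  2^-1 * (d i j l + d j i l - d l i j) * v 0 i * v 0 j.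
have dirE w p q : 'D_w g u p q = \sum_c w 0 c * d c p q.
  rewrite derive_basis // summxE; apply: eq_bigr => c _.
  by rewrite mxE.
have ELE w : euler_lagrange g u v a w = ((a *m g u + L) *m w^T) 0 0.
  rewrite mulmxDl mxE -[(a *m _ *m _) _ _]/(inner _ _ _) /euler_lagrange -addrA.
  congr (_ + _); rewrite mxE !innerE.
  have -> : \sum_i \sum_l v 0 i * 'D_v g u i l * w 0 l =
     \sum_l w 0 l * \sum_i \sum_j 2^-1 * (d i j l + d j i l) * v 0 i * v 0 j.
    rewrite exchange_big /=; apply: eq_bigr => l _.
    have E1 : \sum_i \sum_j 2^-1 * d i j l * v 0 i * v 0 j =
              \sum_i \sum_j 2^-1 * d j i l * v 0 i * v 0 j.
      rewrite exchange_big /=; apply: eq_bigr => i _; apply: eq_bigr => j _.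
      by rewrite -!mulrA [v 0 j * _]mulrC.
    have -> : \sum_i \sum_j 2^-1 * (d i j l + d j i l) * v 0 i * v 0 j =
              \sum_i \sum_j d j i l * v 0 i * v 0 j.
      transitivity (\sum_i \sum_j 2^-1 * d i j l * v 0 i * v 0 j +
                    \sum_i \sum_j 2^-1 * d j i l * v 0 i * v 0 j).
        rewrite -big_split; apply: eq_bigr => i _ /=.
        by rewrite -big_split; apply: eq_bigr => j _ /=; rewrite mulrDr !mulrDl.
      rewrite E1 -big_split; apply: eq_bigr => i _ /=.
      rewrite -big_split; apply: eq_bigr => j _ /=.
      by field.
    rewrite mulr_sumr; apply: eq_bigr => i _.
    rewrite dirE [in LHS]mulr_sumr [in LHS]mulr_suml [in RHS]mulr_sumr.
    apply: eq_bigr => j _.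
    by ring.
  have -> : 2^-1 * (\sum_i \sum_j v 0 i * 'D_w g u i j * v 0 j) =
     \sum_l w 0 l * \sum_i \sum_j 2^-1 * d l i j * v 0 i * v 0 j.
    transitivity (\sum_i \sum_j \sum_l
        w 0 l * (2^-1 * d l i j * v 0 i * v 0 j)).
      rewrite mulr_sumr; apply: eq_bigr => i _.
      rewrite mulr_sumr; apply: eq_bigr => j _.
      rewrite dirE mulr_sumr mulr_suml mulr_sumr; apply: eq_bigr => l _.
      by ring.
    exact: factor_sum3.
  rewrite -sumrB; apply: eq_bigr => l _.
  rewrite -mulrBr [RHS]mulrC !mxE; congr (_ * _).
  rewrite -sumrB; apply: eq_bigr => i _.
  by rewrite -sumrB; apply: eq_bigr => j _; ring.
have CE k : \sum_i \sum_j christoffel g u k i j * v 0 i * v 0 j =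
    (L *m invmx (g u)) 0 k.
  have gis : (invmx (g u))^T = invmx (g u) by rewrite trmx_inv gs.
  rewrite mxE.
  transitivity (\sum_i \sum_j \sum_l invmx (g u) k l *
     (2^-1 * (d i j l + d j i l - d l i j) * v 0 i * v 0 j)).
    apply: eq_bigr => i _; apply: eq_bigr => j _.
    rewrite /christoffel mulr_sumr !mulr_suml; apply: eq_bigr => l _.
    have dE c p q : 'D_(delta_mx 0 c) (fun y => g y p q) u = d c p q.
      exact: derive_coord.
    by rewrite !dE; ring.
  rewrite factor_sum3; apply: eq_bigr => l _.
  by rewrite mulrC -[in RHS]gis !mxE.
split=> [H w|H k].
  rewrite ELE; suff -> : a *m g u + L = 0 by rewrite mul0mx mxE.
  have E : a + L *m invmx (g u) = 0.
    by apply/rowP => k; rewrite mxE -CE H mxE.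
  by rewrite -(mulmxKV gu L) -mulmxDl E mul0mx.
suff /rowP/(_ k) : a + L *m invmx (g u) = 0 by rewrite CE mxE [RHS]mxE.
have E : a *m g u + L = 0.
  apply/rowP => l; have := H (delta_mx 0 l).
  by rewrite ELE trmx_delta -colE mxE => ->; rewrite mxE.
by rewrite -(mulmxK gu a) -mulmxDl E mul0mx.
Qed.
End EulerLagrange.

Section EulerLagrangePullback.
Context (R : realType).

Lemma inner_euler_lagrange n (H Hv Hw : 'M[R]_n) (v w a vv vw : 'rV[R]_n)
    (ga gv gw : R) :
  H^T = H -> ga = inner H a w ->
  gv = inner Hv v w + inner H vv w + inner H v vw ->
  gw = inner Hw v v + inner H vw v + inner H v vw ->
  inner H (a + vv) w + inner Hv v w - 2^-1 * inner Hw v v =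
  ga + gv - 2^-1 * gw.
Proof.
move=> Hs -> -> ->; rewrite innerDl [inner H vw v]inner_symm //.
by field.
Qed.

(** Differentiating the relation between [g] and [h] produces terms with second
    derivatives of [phi]. One of them is absorbed by the transformed
    acceleration, and the others cancel because second derivatives commute and
    [h] is symmetric. *)
Lemma euler_lagrange_pullback n m (g : 'rV[R]_n -> 'M[R]_n)
    (h : 'rV[R]_m -> 'M[R]_m) (phi : 'rV[R]_n -> 'rV[R]_m)
    (A : set 'rV[R]_n) (u v a w : 'rV[R]_n) :
  open A -> A u -> smooth_on A phi ->
  differentiable g u -> differentiable h (phi u) ->
  (h (phi u))^T = h (phi u) ->
  (forall y, A y -> forall p q,
     inner (g y) p q = inner (h (phi y)) ('D_p phi y) ('D_q phi y)) ->
  euler_lagrange h (phi u) ('D_v phi u)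
    ('D_a phi u + 'D_v ('D_v phi) u) ('D_w phi u) =
  euler_lagrange g u v a w.
Proof.
move=> Ao Au sphi dg dh hs pull.
have dphi : differentiable phi u by exact: smooth_on_differentiable sphi Au.
have dD p : differentiable ('D_p phi) u.
  by apply: smooth_on_differentiable Au; exact: smooth_on_derive.
have dhphi : differentiable (h \o phi) u by exact: differentiable_comp.
have diff_pull z p q : inner ('D_z g u) p q =
    inner ('D_('D_z phi u) h (phi u)) ('D_p phi u) ('D_q phi u) +
    inner (h (phi u)) ('D_z ('D_p phi) u) ('D_q phi u) +
    inner (h (phi u)) ('D_p phi u) ('D_z ('D_q phi) u).
  have dc (c : 'rV[R]_n) : differentiable (fun=> c : 'rV[R]_n) u.
    exact: differentiable_cst.
  have [_] := is_derive_inner z dg (dc p) (dc q).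
  have Dc (c : 'rV[R]_n) : 'D_z (fun=> c) u = 0 by exact: derive_cst.
  have i0l : inner (g u) 0 q = 0 by rewrite /inner !mul0mx mxE.
  have i0r : inner (g u) p 0 = 0 by rewrite /inner trmx0 mulmx0 mxE.
  rewrite !Dc i0l i0r !addr0 => <-.
  rewrite (@near_eq_derive _ _ _ _
    (fun y => inner ((h \o phi) y) ('D_p phi y) ('D_q phi y))); last first.
    by have := open_nbhs_nbhs (conj Ao Au); apply: filterS => y Ay; exact: pull.
  have [_ ->] := is_derive_inner z dhphi (dD p) (dD q).
  by rewrite derive_comp.
have Ev := diff_pull v v w.
rewrite (derive_swap v w Ao sphi Au) in Ev.
exact: (inner_euler_lagrange hs (pull u Au a w) Ev (diff_pull w v v)).
Qed.

(** The velocity of [phi \o x] is the image of the velocity of [x]; its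
    acceleration acquires the second derivative of [phi] along the velocity,
    which is the term that [euler_lagrange_pullback] expects. *)
Lemma derive2_comp n m (phi : 'rV[R]_n -> 'rV[R]_m) (A : set 'rV[R]_n)
    (x : R -> 'rV[R]_n) (t : R) :
  open A -> smooth_on A phi -> A (x t) ->
  (\forall s \near t, differentiable x s) -> differentiable (derive1 x) t ->
  derive1 (phi \o x) t = 'D_(derive1 x t) phi (x t) /\
  derive1n 2 (phi \o x) t = 'D_(derive1n 2 x t) phi (x t) +
    'D_(derive1 x t) ('D_(derive1 x t) phi) (x t).
Proof.
move=> Ao sphi Axt dxs ddx1.
have dxt : differentiable x t by exact: nbhs_singleton dxs.
have first s : A (x s) -> differentiable x s ->
    derive1 (phi \o x) s = 'D_(derive1 x s) phi (x s).
  move=> Axs dxs'; rewrite !derive1E derive_comp //.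
  exact: smooth_on_differentiable sphi Axs.
split; first exact: first.
have Anear : \forall s \near t, A (x s).
  by apply: (differentiable_continuous dxt); exact: open_nbhs_nbhs.
pose E (j : 'I_n) : 'rV[R]_n := delta_mx 0 j.
have dpart j : differentiable ('D_(E j) phi \o x) t.
  apply: differentiable_comp => //.
  by apply: smooth_on_differentiable Axt; exact: smooth_on_derive.
have dcoord j : differentiable (fun s => derive1 x s 0 j) t.
  exact: differentiable_entry.
have -> : derive1n 2 (phi \o x) t =
    'D_1 (fun s => \sum_j derive1 x s 0 j *: ('D_(E j) phi \o x) s) t.
  rewrite derive1nS derive1n1 derive1E; apply: near_eq_derive.
  near=> s.
  have As : A (x s) by near: s.
  rewrite first //; last by near: s.
  by rewrite derive_basis //; exact: smooth_on_differentiable sphi As.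
have dsc j := is_diff_scale (dcoord j) (dpart j).
have -> : (fun s => \sum_j derive1 x s 0 j *: ('D_(E j) phi \o x) s) =
  \sum_j (fun s => derive1 x s 0 j *: ('D_(E j) phi \o x) s).
  by apply/funext => s; rewrite fct_sumE.
rewrite derive_sum; last by move=> j; apply: diff_derivable; case: (dsc j).
have term j : 'D_1 (fun s => derive1 x s 0 j *: ('D_(E j) phi \o x) s) t =
   derive1n 2 x t 0 j *: 'D_(E j) phi (x t) +
   derive1 x t 0 j *: 'D_(derive1 x t) ('D_(E j) phi) (x t).
  rewrite (derive_scale _ (dcoord j) (dpart j)).
  have -> : 'D_1 (fun s => derive1 x s 0 j) t = derive1n 2 x t 0 j.
    by rewrite derive1nS derive1n1 derive1E; exact: derive_coord.
  have -> : 'D_1 ('D_(E j) phi \o x) t =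
      'D_(derive1 x t) ('D_(E j) phi) (x t).
    rewrite derive1E; apply: derive_comp => //.
    by apply: smooth_on_differentiable Axt; exact: smooth_on_derive.
  by [].
under eq_bigr do rewrite term.
rewrite big_split /= -derive_basis; last exact: smooth_on_differentiable Axt.
congr (_ + _).
rewrite [RHS]derive_basis; last first.
  by apply: smooth_on_differentiable Axt; exact: smooth_on_derive.
apply: eq_bigr => j _.
by rewrite (derive_swap (derive1 x t) (E j) Ao sphi Axt).
Unshelve. all: by end_near. Qed.

End EulerLagrangePullback.

(** * Composition of smooth and of metric-preserving maps *)

Section LocalRepresentatives.
Context (R : realType).

Lemma local_dom_open (T T' : topologicalType) n n' (c : chart R T n)
    (d : chart R T' n') (f : T -> T') :
  continuous f -> open (local_dom c d f).
Proof.
move=> fc; rewrite openE => u [cu du].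
have cc := @chart_inv_continuous _ _ _ c u cu.
apply: filterI.
  by apply: open_nbhs_nbhs; split=> //; exact: chart_img_open.
have : {for u, continuous (f \o chart_inv c)}.
  by apply: continuous_comp => //; exact: fc.
by apply; apply: open_nbhs_nbhs; split=> //; exact: chart_dom_open.
Qed.

Lemma smooth_map_on (M N : manifold R) (f : M -> N)
    (i : atlas_index M) (j : atlas_index N) : smooth_map f ->
  smooth_on (local_dom (atlas i) (atlas j) f) (local_rep (atlas i) (atlas j) f).
Proof. by case. Qed.

Lemma local_rep_dom (M N P : manifold R) (f : M -> N) (g : N -> P)
    (i : atlas_index M) (j : atlas_index N) (k : atlas_index P) u :
  local_dom (atlas i) (atlas j) f u -> local_dom (atlas i) (atlas k) (g \o f) u ->
  local_dom (atlas j) (atlas k) g (local_rep (atlas i) (atlas j) f u).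
Proof.
move=> [iu ju] [_ ku]; split; first exact: chart_map_img.
by rewrite /local_rep chart_mapK.
Qed.

Lemma local_rep_comp (M N P : manifold R) (f : M -> N) (g : N -> P)
    (i : atlas_index M) (j : atlas_index N) (k : atlas_index P) u :
  continuous f -> local_dom (atlas i) (atlas j) f u ->
  {near u, local_rep (atlas j) (atlas k) g \o local_rep (atlas i) (atlas j) f
           =1 local_rep (atlas i) (atlas k) (g \o f)}.
Proof.
move=> fc uij; have := local_dom_open (c := atlas i) (d := atlas j) fc.
move=> /(fun H => open_nbhs_nbhs (conj H uij)); apply: filterS => y [_ jy].
by rewrite /local_rep /= chart_mapK.
Qed.

(** Near a given point the middle manifold is described by a single chart, and
    there the coordinate expression of the composite is the composite of two
    coordinate expressions. *)
Lemma smooth_map_comp (M N P : manifold R) (f : M -> N) (g : N -> P) :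
  smooth_map f -> smooth_map g -> smooth_map (g \o f).
Proof.
move=> sf sg; have fc := sf.1; have gc := sg.1.
have gfc : continuous (g \o f) by move=> x; apply: continuous_comp; [exact: fc|exact: gc].
split=> // i k; apply: smooth_on_local => u uik.
have [j ju] := @atlas_cover _ _ N (f (chart_inv (atlas i) u)).
have uij : local_dom (atlas i) (atlas j) f u by split=> //; case: uik.
exists (local_rep (atlas j) (atlas k) g \o local_rep (atlas i) (atlas j) f).
exists (local_dom (atlas i) (atlas j) f `&` local_dom (atlas i) (atlas k) (g \o f)).
split; [by [] | | exact: local_rep_comp].
apply: (@smooth_on_comp _ _ _ _ _ (local_dom (atlas j) (atlas k) g)).
- by apply: openI; exact: local_dom_open.
- by move=> y [y1 y2]; exact: local_rep_dom.
- by apply: smooth_on_sub (smooth_map_on i j sf); exact: subIsetl.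
- exact: smooth_map_on.
Qed.

Lemma derive_local_rep_comp (M N P : manifold R) (f : M -> N) (g : N -> P)
    (i : atlas_index M) (j : atlas_index N) (k : atlas_index P) u v :
  smooth_map f -> smooth_map g ->
  local_dom (atlas i) (atlas j) f u -> local_dom (atlas i) (atlas k) (g \o f) u ->
  'D_v (local_rep (atlas i) (atlas k) (g \o f)) u =
  'D_('D_v (local_rep (atlas i) (atlas j) f) u) (local_rep (atlas j) (atlas k) g)
    (local_rep (atlas i) (atlas j) f u).
Proof.
move=> sf sg uij uik.
rewrite -(near_eq_derive _ (local_rep_comp g k sf.1 uij)).
apply: derive_comp.
  exact: smooth_on_differentiable (smooth_map_on i j sf) uij.
apply: smooth_on_differentiable (smooth_map_on j k sg) _.
exact: local_rep_dom.
Qed.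

Lemma is_pullback_comp (M N P : manifold R) (gM : gram_field M)
    (gN : gram_field N) (gP : gram_field P) (f : M -> N) (g : N -> P) :
  smooth_map f -> smooth_map g ->
  is_pullback gM gN f -> is_pullback gN gP g -> is_pullback gM gP (g \o f).
Proof.
move=> sf sg pf pg i k u uik v w.
have [j ju] := @atlas_cover _ _ N (f (chart_inv (atlas i) u)).
have uij : local_dom (atlas i) (atlas j) f u by split=> //; case: uik.
rewrite (pf i j u uij) (pg j k _ (local_rep_dom uij uik)).
rewrite !(derive_local_rep_comp _ sf sg uij uik).
by rewrite -(nbhs_singleton (local_rep_comp g k sf.1 uij)).
Qed.

Lemma deriveB_dir n m (f : 'rV[R]_n -> 'rV[R]_m) u v w : differentiable f u ->
  'D_(v - w) f u = 'D_v f u - 'D_w f u.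
Proof. by move=> df; rewrite !deriveE // linearB. Qed.

(** A tangent vector killed by the derivative would have length zero for the
    pulled back metric, which is positive definite. *)
Lemma pullback_immersion (M N : riemannian_manifold R) (f : M -> N) :
  smooth_map f -> is_pullback (@metric R M) (@metric R N) f -> immersion f.
Proof.
move=> sf pf; split=> // i j u uij v w /= vw.
have df := smooth_on_differentiable (smooth_map_on i j sf) uij.
apply/eqP; rewrite -subr_eq0; apply/negPn/negP => vw0.
have := metric_pos uij.1 vw0.
rewrite (pf i j u uij) deriveB_dir // vw subrr /inner trmx0 mulmx0 mxE.
by rewrite ltxx.
Qed.

Lemma metric_unit (M : riemannian_manifold R) (i : atlas_index M) u :
  chart_img (atlas i) u -> metric i u \in unitmx.
Proof.
move=> iu; rewrite -row_free_unit -kermx_eq0; apply/eqP/row_matrixP => k.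
rewrite row0; apply/eqP/negPn/negP => /(metric_pos iu).
have /sub_kermxP E : (row k (kermx (metric i u)) <= kermx (metric i u))%MS.
  exact: row_sub.
by rewrite /inner E mul0mx mxE ltxx.
Qed.

End LocalRepresentatives.

(** * Isometries preserve geodesics *)

Section Geodesics.
Context (R : realType) (M : riemannian_manifold R).

Lemma smooth_curve_comp (f : M -> M) (J : set R) (c : R -> M) :
  open J -> smooth_map f -> smooth_curve J c -> smooth_curve J (f \o c).
Proof.
move=> Jo sf [cc cs]; have fc := sf.1.
have fcc t : J t -> {for t, continuous (f \o c)}.
  by move=> Jt; apply: continuous_comp; [exact: cc|exact: fc].
split=> // j; apply: smooth_on_local => t [Jt jt].
have [i it] := @atlas_cover _ _ M (c t).
exists (local_rep (atlas i) (atlas j) f \o (chart_map (atlas i) \o c)).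
exists (J `&` c @^-1` chart_dom (atlas i) `&` (f \o c) @^-1` chart_dom (atlas j)).
have Bo : open (J `&` c @^-1` chart_dom (atlas i) `&`
    (f \o c) @^-1` chart_dom (atlas j)).
  rewrite openE => s [[Js is_] js]; apply: filterI; first apply: filterI.
  - exact: open_nbhs_nbhs.
  - by apply: (cc s Js); apply: open_nbhs_nbhs; split=> //; exact: chart_dom_open.
  - by apply: (fcc s Js); apply: open_nbhs_nbhs; split=> //; exact: chart_dom_open.
split=> //; last first.
  have : nbhs t (J `&` c @^-1` chart_dom (atlas i) `&`
    (f \o c) @^-1` chart_dom (atlas j)) by exact: open_nbhs_nbhs.
  by apply: filterS => s [[_ is_] _]; rewrite /local_rep /= chart_mapK.
apply: (@smooth_on_comp _ _ _ _ _ (local_dom (atlas i) (atlas j) f)) => //.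
- move=> s [[_ is_] js]; split; first exact: chart_map_img.
  by rewrite /= chart_mapK.
- by apply: smooth_on_sub (cs i); exact: subIsetl.
- exact: smooth_map_on.
Qed.

(** In charts the map [f] has an invertible derivative, so every test vector at
    the image point is the image of a test vector; [euler_lagrange_pullback]
    then transports the geodesic equation. *)
Lemma geodesic_comp (f : M -> M) (J : set R) (c : R -> M) :
  open J -> smooth_map f -> is_pullback (@metric R M) (@metric R M) f ->
  geodesic_on J c -> geodesic_on J (f \o c).
Proof.
move=> Jo sf pf [sc gc]; have sfc := smooth_curve_comp Jo sf sc.
split=> // j t Jt jt.
have [i it] := @atlas_cover _ _ M (c t).
pose x := chart_map (atlas i) \o c.
pose phi := local_rep (atlas i) (atlas j) f.
pose A := local_dom (atlas i) (atlas j) f.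
have Ao : open A by apply: local_dom_open; exact: sf.1.
have sphi : smooth_on A phi by exact: smooth_map_on.
have Axt : A (x t).
  by split; [exact: chart_map_img|rewrite /x /= chart_mapK].
have sx := sc.2 i.
have nearI : \forall s \near t, (J `&` c @^-1` chart_dom (atlas i)) s.
  apply: filterI; first exact: open_nbhs_nbhs.
  by apply: (sc.1 t Jt); apply: open_nbhs_nbhs; split=> //; exact: chart_dom_open.
have dx : \forall s \near t, differentiable x s.
  by apply: filterS nearI => s; exact: smooth_on_differentiable.
have d1x : differentiable (derive1 x) t.
  have -> : derive1 x = 'D_1 x by apply/funext => s; rewrite derive1E.
  apply: smooth_on_differentiable (nbhs_singleton nearI).
  exact: smooth_on_derive.
have [y1 y2] := derive2_comp Ao sphi Axt dx d1x.
have near_y : {near t, chart_map (atlas j) \o (f \o c) =1 phi \o x}.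
  apply: filterS nearI => s [_ is_].
  by rewrite /phi /x /local_rep /= chart_mapK.
have y1' : derive1 (chart_map (atlas j) \o (f \o c)) t =
    'D_(derive1 x t) phi (x t).
  by rewrite -y1 !derive1E; exact: near_eq_derive.
have y2' : derive1n 2 (chart_map (atlas j) \o (f \o c)) t =
    'D_(derive1n 2 x t) phi (x t) +
    'D_(derive1 x t) ('D_(derive1 x t) phi) (x t).
  rewrite -y2 -[LHS]/(derive1 (derive1 _) t) -[RHS]/(derive1 (derive1 _) t).
  rewrite !derive1E; apply: near_eq_derive.
  have := nbhs_interior near_y; apply: filterS => s near_ys.
  by rewrite !derive1E; exact: near_eq_derive.
have yt : (chart_map (atlas j) \o (f \o c)) t = phi (x t).
  exact: nbhs_singleton near_y.
have dmetric k u : chart_img (atlas k) u -> differentiable (@metric R M k) u.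
  exact: smooth_on_differentiable (@metric_smooth _ M k).
have jy : chart_img (atlas j) (phi (x t)).
  by rewrite -yt; exact: chart_map_img.
have ix : chart_img (atlas i) (x t) by exact: chart_map_img.
move=> y; rewrite {}/y yt y1' y2'.
apply: (proj2 (christoffel_euler_lagrange _ _ _ _ _)).
- exact: dmetric jy.
- exact: Defs.metric_sym jy.
- exact: metric_unit jy.
have dphi : differentiable phi (x t) by exact: smooth_on_differentiable sphi Axt.
have [_ /(_ i j (x t) Axt) inj] := pullback_immersion sf pf.
have unitJ : jacobian phi (x t) \in unitmx.
  rewrite -row_free_unit -kermx_eq0; apply/eqP/row_matrixP => k.
  rewrite row0; apply: inj; rewrite !deriveEjacobian // mul0mx.
  by apply/sub_kermxP; exact: row_sub.
move=> w.
have -> : w = 'D_(w *m invmx (jacobian phi (x t))) phi (x t).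
  by rewrite deriveEjacobian // mulmxKV.
apply: etrans (euler_lagrange_pullback _ _ _ Ao Axt sphi (dmetric i _ ix)
  (dmetric j _ jy) (Defs.metric_sym jy) (pf i j)) _.
apply: (proj1 (christoffel_euler_lagrange _ _ _ _ _)).
- exact: dmetric ix.
- exact: Defs.metric_sym ix.
- exact: metric_unit ix.
- exact: gc.
Qed.

End Geodesics.

(** * Translates of a submanifold *)

Section Translates.
Context (R : realType) (M : riemannian_manifold R) (G : lie_group R).
Context (a : isometric_action G M).

Lemma act_smooth_map g : smooth_map (a g).
Proof. by have [] := act_isometry a g. Qed.

Lemma act_pullback g : is_pullback (@metric R M) (@metric R M) (a g).
Proof. by have [] := act_isometry a g. Qed.

Lemma actK g : cancel (a g) (a g^-1%g).
Proof. by move=> x; rewrite -actM mulVg act1. Qed.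

Lemma actKV g : cancel (a g^-1%g) (a g).
Proof. by move=> x; rewrite -actM mulgV act1. Qed.

Lemma translate_pullback g (S : submanifold M) :
  is_pullback (@metric R S) (@metric R M) (a g \o @sub_incl R M S).
Proof.
have [sm _] := @sub_incl_immersion R M S.
exact: (is_pullback_comp sm (act_smooth_map g) (@sub_induced_metric R M S)
  (@act_pullback g)).
Qed.

Lemma translate_smooth g (S : submanifold M) :
  smooth_map (a g \o @sub_incl R M S).
Proof.
apply: smooth_map_comp (act_smooth_map g).
by have [] := @sub_incl_immersion R M S.
Qed.

(** The translate keeps the abstract manifold and its metric and only composes
    the immersion with [a g]; completeness, connectedness and the isometry class
    are thus shared with [S] by construction. *)
Definition translate g (S : submanifold M) : submanifold M :=
  Submanifold
    (inj_comp (can_inj (actK g)) (@sub_incl_inj R M S))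
    (pullback_immersion (translate_smooth g S) (@translate_pullback g S))
    (@translate_pullback g S).

Lemma sub_points_translate g (S : submanifold M) :
  sub_points (translate g S) = a g @` sub_points S.
Proof. by rewrite /sub_points image_comp. Qed.

Lemma translate_totally_geodesic g (S : submanifold M) :
  totally_geodesic S -> totally_geodesic (translate g S).
Proof.
move=> [Sc Sg]; split=> // J c Jo gc.
apply: geodesic_comp (act_smooth_map g) (@act_pullback g) (Sg _ _ Jo gc).
by case: Jo.
Qed.

End Translates.

(** * Local comparison of the metric with the coordinate norm *)

Section MetricBounds.
Context (R : realType).

Lemma entry_le_norm m n (A : 'M[R]_(m, n)) i j : `|A i j| <= `|A|.
Proof.
rewrite [leRHS]/Num.Def.normr /= mx_normrE.
exact: (le_bigmax _ (fun ij : 'I_m * 'I_n => `|A ij.1 ij.2|) (i, j)).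
Qed.

Lemma norm_le_entry m n (A : 'M[R]_(m, n)) e : 0 <= e ->
  (forall i j, `|A i j| <= e) -> `|A| <= e.
Proof.
move=> e0 H; rewrite [leLHS]/Num.Def.normr /= mx_normrE.
by apply: bigmax_le => // ij _.
Qed.

Lemma inner_bound n (A : 'M[R]_n) (w : 'rV[R]_n) :
  `|inner A w w| <= (n * n)%:R * `|A| * `|w| ^+ 2.
Proof.
rewrite innerE; apply: le_trans (ler_norm_sum _ _ _) _.
have bound i : `|\sum_j w 0 i * A i j * w 0 j| <= n%:R * (`|A| * `|w| ^+ 2).
  apply: le_trans (ler_norm_sum _ _ _) _.
  rewrite mulr_natl -[X in _ *+ X]card_ord -sumr_const; apply: ler_sum => j _.
  rewrite !normrM [`|w 0 i| * _]mulrC -mulrA expr2.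
  by rewrite !ler_pM // ?mulr_ge0 ?entry_le_norm.
apply: le_trans (ler_sum _ (fun i _ => bound i)) _.
by rewrite sumr_const card_ord -[leLHS]mulr_natl natrM -!mulrA.
Qed.

Lemma innerBl n (A B : 'M[R]_n) w : inner (A - B) w w = inner A w w - inner B w w.
Proof. by rewrite /inner mulmxBr mulmxBl !mxE. Qed.

Lemma innerZ n (A : 'M[R]_n) (c : R) w : inner A (c *: w) (c *: w) = c ^+ 2 * inner A w w.
Proof. by rewrite /inner linearZ /= -!scalemxAl -!scalemxAr !mxE mulrA. Qed.

Lemma inner_continuous n (A : 'M[R]_n) : continuous (fun w => inner A w w).
Proof.
have -> : (fun w => inner A w w) = (fun w => \sum_i \sum_j w 0 i * A i j * w 0 j).
  by apply/funext => v; rewrite innerE.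
suff H : Ck 0 setT (fun w : 'rV[R]_n => \sum_i \sum_j w 0 i * A i j * w 0 j).
  by move=> w; exact: H w I.
apply: Ck_sum openT _ => i; apply: Ck_sum openT _ => j w _.
apply: (@continuousM _ _ (fun w : 'rV[R]_n => w 0 i * A i j)
  (fun w : 'rV[R]_n => w 0 j)); last exact: coord_continuous.
apply: (@continuousM _ _ (fun w : 'rV[R]_n => w 0 i) (fun=> A i j)).
  exact: coord_continuous.
exact: cst_continuous.
Qed.

Lemma metric_upper (N : riemannian_manifold R) (e : atlas_index N) u0 :
  chart_img (atlas e) u0 -> exists C, 0 < C /\ \forall u \near u0,
    chart_img (atlas e) u /\ forall w, inner (metric e u) w w <= C * `|w| ^+ 2.
Proof.
move=> eu0; set n := mdim N.
have cm : {for u0, continuous (metric e)}.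
  exact: smooth_on_continuous (@metric_smooth _ N e) eu0.
exists ((n * n)%:R * (`|metric e u0| + 1) + 1); split.
  by rewrite ltr_wpDl // mulr_ge0 // addr_ge0.
have nearC : \forall u \near u0, `|metric e u0 - metric e u| < 1.
  by move/cvgrPdist_lt: cm; apply.
near=> u; split.
  by near: u; apply: open_nbhs_nbhs; split=> //; exact: chart_img_open.
move=> w; apply: le_trans (ler_norm _) _; apply: le_trans (inner_bound _ _) _.
apply: ler_wpM2r; first exact: exprn_ge0.
have lt1 : `|metric e u0 - metric e u| < 1 by near: u.
have le1 : `|metric e u| <= `|metric e u0| + 1.
  rewrite -[metric e u](subKr (metric e u0)).
  by apply: le_trans (ler_normB _ _) _; rewrite lerD2l ltW.
apply: le_trans (_ : (n * n)%:R * (`|metric e u0| + 1) <= _).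
  exact: ler_wpM2l.
by rewrite lerDl.
Unshelve. all: by end_near. Qed.

(** The quadratic form attains a positive minimum on the unit sphere, which is
    compact; homogeneity extends the bound to all vectors. In dimension zero the
    sphere is empty and any constant will do. *)
Lemma pos_def_lower n (A : 'M[R]_n) :
  (forall w, w != 0 -> 0 < inner A w w) ->
  exists2 m, 0 < m & forall w, m * `|w| ^+ 2 <= inner A w w.
Proof.
move=> pos.
have inner0 : inner A 0 0 = 0 by rewrite /inner !mul0mx mxE.
pose sph := [set w : 'rV[R]_n | `|w| = 1].
have [[w1 sw1]|no] := pselect (sph !=set0); last first.
  exists 1 => // w; have [->|w0] := eqVneq w 0.
    by rewrite normr0 expr0n mulr0 inner0.
  exfalso; apply: no; exists (`|w|^-1 *: w).
  by rewrite /sph /= normrZ normfV normr_id mulVf // normr_eq0.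
have csph : compact sph.
  apply: bounded_closed_compact.
    exists 1; split; first exact: num_real.
    by move=> M M1 w /= ->; exact: ltW.
  have -> : sph = (fun w : 'rV[R]_n => `|w|) @^-1` [set 1] by [].
  apply: closed_comp; first by move=> w _; exact: norm_continuous.
  exact: closed_eq.
have [|c] := @EVT_min_rV R n (fun w => inner A w w) sph
  (ex_intro _ w1 sw1) csph.
  by apply: continuous_subspaceT; exact: inner_continuous.
rewrite inE => sc cmin.
exists (inner A c c).
  by apply: pos; rewrite -normr_eq0 sc oner_eq0.
move=> w; have [->|w0] := eqVneq w 0.
  by rewrite normr0 expr0n mulr0 inner0.
have := cmin (`|w|^-1 *: w); rewrite inE innerZ exprVn => le.
rewrite mulrC -ler_pdivlMl ?exprn_gt0 ?normr_gt0 //; apply: le.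
by rewrite /sph /= normrZ normfV normr_id mulVf // normr_eq0.
Qed.

(** The bound at [u0] survives, with half the constant, a perturbation of the
    metric that is small compared with that constant. *)
Lemma metric_lower (N : riemannian_manifold R) (e : atlas_index N) u0 :
  chart_img (atlas e) u0 -> exists m, 0 < m /\ \forall u \near u0,
    chart_img (atlas e) u /\ forall w, m * `|w| ^+ 2 <= inner (metric e u) w w.
Proof.
move=> eu0; set n := mdim N.
have cm : {for u0, continuous (metric e)}.
  exact: smooth_on_continuous (@metric_smooth _ N e) eu0.
have [m m0 mle] := pos_def_lower (metric_pos eu0).
have k0 : 0 < (n * n)%:R + 1 :> R by rewrite ltr_wpDl.
exists (m / 2); split; first exact: divr_gt0.
(* by inner_bound this makes the perturbation at most [m / 2] *)
have e0 : 0 < m / 2 / ((n * n)%:R + 1) by rewrite !divr_gt0.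
have nearC : \forall u \near u0,
    `|metric e u0 - metric e u| < m / 2 / ((n * n)%:R + 1).
  by move/cvgrPdist_lt: cm; apply.
near=> u; split.
  by near: u; apply: open_nbhs_nbhs; split=> //; exact: chart_img_open.
move=> w.
have lt1 : `|metric e u0 - metric e u| < m / 2 / ((n * n)%:R + 1) by near: u.
have diff : inner (metric e u0) w w - inner (metric e u) w w <= m / 2 * `|w| ^+ 2.
  rewrite -innerBl; apply: le_trans (ler_norm _) _.
  apply: le_trans (inner_bound _ _) _; apply: ler_wpM2r; first exact: exprn_ge0.
  apply: le_trans (_ : ((n * n)%:R + 1) * `|metric e u0 - metric e u| <= _).
    by apply: ler_wpM2r => //; rewrite lerDl.
  by rewrite -ler_pdivlMl // mulrC ltW.
have := mle w; move: diff.
move: (inner (metric e u0) w w) (inner (metric e u) w w) (`|w| ^+ 2) => x y z.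
by lra.
Unshelve. all: by end_near. Qed.

End MetricBounds.

(** * Slow curves and equicontinuity of metric-preserving maps *)

Section SlowCurves.
Context (R : realType).

Lemma norm_MVT n (x : R -> 'rV[R]_n) (t e : R) : 0 <= t -> 0 <= e ->
  (forall s : R, 0 <= s <= t -> derivable x s 1) ->
  (forall s : R, 0 < s < t -> `|'D_1 x s| <= e) ->
  `|x t - x 0| <= e * t.
Proof.
move=> t0 e0 dx bx; move: t0; rewrite le_eqVlt => /orP[/eqP<-|t0].
  by rewrite subrr normr0 mulr0.
apply: norm_le_entry; first by rewrite mulr_ge0 // ltW.
move=> i k; rewrite ord1 => {i}.
have dk (s : R) : 0 <= s <= t -> derivable (fun s => x s 0 k) s 1.
  by move=> st; have /derivable_mxP := dx s st; apply.
have [||c] := @MVT R (fun s => x s 0 k) (fun s => 'D_1 (fun s => x s 0 k) s) 0 t t0.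
- move=> s; rewrite in_itv /= => /andP[s0 st]; apply: derivableP.
  by apply: dk; rewrite !ltW.
- apply: derivable_within_continuous => s; rewrite in_itv /=; exact: dk.
rewrite in_itv /= => /andP[c0 ct]; rewrite subr0 !mxE => ->.
rewrite normrM (gtr0_norm t0) ler_pM2r //.
have -> : 'D_1 (fun s => x s 0 k) c = 'D_1 x c 0 k.
  by rewrite derive_mx ?mxE //; apply: dx; rewrite !ltW.
by apply: le_trans (entry_le_norm _ _ _) (bx _ _); rewrite c0.
Qed.

Lemma chart_ball_compact (M : manifold R) (j : atlas_index M) u0 e :
  (forall u, `|u0 - u| <= e -> chart_img (atlas j) u) ->
  compact (chart_inv (atlas j) @` [set u | `|u0 - u| <= e]).
Proof.
move=> img; apply: continuous_compact.
  apply: continuous_in_subspaceT => u; rewrite inE => uB.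
  by apply: chart_inv_continuous; exact: img.
apply: bounded_closed_compact; last exact: closed_closed_ball_.
exists (`|u0| + e); split; first exact: num_real.
move=> K KM u /= uB; apply/ltW/(le_lt_trans _ KM).
rewrite -[u](subKr u0); apply: le_trans (ler_normB _ _) _.
by rewrite lerD2l.
Qed.

(** Up to a first exit time from the chart ball of radius [d], the mean value
    theorem confines the curve to the closed ball of radius [e < d]. That ball
    is compact, hence closed in the manifold, so at the exit time the curve would
    still be in it: there is no exit. *)
Lemma slow_curve_stays (M : riemannian_manifold R) (j : atlas_index M)
    (c : R -> M) (m d e : R) :
  let x := chart_map (atlas j) \o c in
  chart_dom (atlas j) (c 0) -> 0 < m -> 0 <= e < d ->
  (forall u, `|x 0 - u| < d -> chart_img (atlas j) u /\
     forall w, m * `|w| ^+ 2 <= inner (metric j u) w w) ->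
  (forall t : R, 0 <= t <= 1 -> {for t, continuous c}) ->
  (forall t : R, 0 <= t <= 1 -> chart_dom (atlas j) (c t) ->
     derivable x t 1 /\
     inner (metric j (x t)) ('D_1 x t) ('D_1 x t) <= m * e ^+ 2) ->
  chart_dom (atlas j) (c 1) /\ `|x 0 - x 1| < d.
Proof.
move=> x j0 m0 /andP[e0 ed] ball_d cc slow.
pose inside t := chart_dom (atlas j) (c t) /\ `|x 0 - x t| < d.
have d0 : 0 < d by exact: le_lt_trans ed.
have inside0 : inside 0 by split=> //; rewrite subrr normr0.
have inside_open (t : R) : 0 <= t <= 1 -> inside t -> \forall s \near t, inside s.
  move=> t01 [jt xt].
  have cx : {for t, continuous x}.
    by apply: continuous_comp; [exact: cc|exact: chart_map_continuous].
  apply: filterI.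
    by apply: (cc t t01); apply: open_nbhs_nbhs; split=> //; exact: chart_dom_open.
  have r0 : 0 < d - `|x 0 - x t| by rewrite subr_gt0.
  move/cvgrPdist_lt : cx => /(_ _ r0); apply: filterS => s.
  rewrite ltrBrDl; apply: le_lt_trans.
  by apply: le_trans (ler_normD _ _); rewrite addrA subrK.
have speed (t : R) : 0 <= t <= 1 -> inside t -> `|'D_1 x t| <= e.
  move=> t01 [jt xt]; have [_ le1] := slow t t01 jt.
  have [_ /(_ ('D_1 x t)) le2] := ball_d _ xt.
  have := le_trans le2 le1; rewrite ler_pM2l //.
  by rewrite ler_pXn2r // nnegrE.
pose K := chart_inv (atlas j) @` [set u | `|x 0 - u| <= e].
have Kclosed : closed K.
  apply: compact_closed; first exact: (smooth_hausdorff M).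
  apply: chart_ball_compact => u ue; apply: (ball_d u _).1.
  exact: le_lt_trans ue ed.
have stepK (t : R) : 0 <= t <= 1 -> (forall s : R, 0 <= s <= t -> inside s) -> K (c t).
  move=> /andP[t0 t1] ins.
  have [jt _] : inside t by apply: ins; rewrite t0 lexx.
  exists (x t); last by rewrite /x /= chart_mapK.
  rewrite /= distrC.
  apply: le_trans (_ : e * t <= e); last by rewrite ler_piMr.
  apply: norm_MVT => // s /andP[s0 st].
    by apply: (slow s _ _).1; [rewrite s0 (le_trans st)|apply: (ins s _).1; rewrite s0].
  by apply: speed; [rewrite !ltW // (lt_le_trans st)|apply: ins; rewrite !ltW].
have KI (t : R) : K (c t) -> inside t.
  move=> [u ue ut]; have [iu _] := ball_d u (le_lt_trans ue ed).
  rewrite /inside /x /= -ut; split; first exact: chart_inv_dom.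
  by rewrite chart_invK // (le_lt_trans ue).
pose T := [set t : R | 0 <= t <= 1 /\ forall s : R, 0 <= s <= t -> inside s].
have T0 : T 0.
  by split=> [|s]; rewrite ?lexx //= -eq_le => /eqP <-.
have T1 : ubound T 1 by move=> t [/andP[]].
have hasT : has_sup T by split; [exists 0|exists 1].
have sT0 : 0 <= sup T by apply: ub_le_sup; case: hasT.
have sT1 : sup T <= 1 by apply: sup_le_ub => //; exists 0.
have below (s : R) : 0 <= s < sup T -> inside s.
  move=> /andP[s0 ss].
  have [t [_ Tt] st] := sup_adherent (eps := sup T - s) ltac:(by rewrite subr_gt0) hasT.
  by apply: Tt; rewrite s0 ltW //; move: st; rewrite subKr.
have insideT : inside (sup T).
  have [->//|Tn0] := eqVneq (sup T) 0.
  have Tpos : 0 < sup T by rewrite lt_neqAle eq_sym Tn0.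
  apply: KI; apply: contrapT => nK.
  have : \forall s \near sup T, ~ K (c s).
    have ccT : {for sup T, continuous c} by apply: cc; rewrite sT0.
    apply: (ccT (~` K)); apply: open_nbhs_nbhs; split=> //.
    exact: closed_openC.
  move=> /nbhs_ballP[r /= r0 rB].
  pose s := Num.max 0 (sup T - r / 2).
  have s0 : 0 <= s by rewrite le_max lexx.
  have sT : s < sup T by rewrite gt_max Tpos ltrBlDr ltrDl divr_gt0.
  apply: (rB s).
    rewrite /ball /= ger0_norm ?subr_ge0 ?ltW //.
    rewrite ltrBlDr -ltrBlDl lt_max; apply/orP; right.
    by rewrite ltrD2l ltrN2 ltr_pdivrMr // ltr_pMr // ltr1n.
  apply: stepK; first by rewrite s0 (le_trans (ltW sT)).
  by move=> s' /andP[s'0 s's]; apply: below; rewrite s'0 (le_lt_trans s's).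
have TsT : T (sup T).
  split; first by rewrite sT0.
  move=> s /andP[s0]; rewrite le_eqVlt => /orP[/eqP->//|ss].
  by apply: below; rewrite s0.
(* an exit time before [1] is excluded because being inside is open *)
have [<-//|Tn1] := eqVneq (sup T) 1.
have Tlt1 : sup T < 1 by rewrite lt_neqAle Tn1.
have := inside_open _ TsT.1 insideT => /nbhs_ballP[r /= r0 rB].
pose t := Num.min 1 (sup T + r / 2).
have tgt : sup T < t by rewrite lt_min Tlt1 ltrDl divr_gt0.
suff Tt : T t by have := ub_le_sup hasT.2 Tt; rewrite leNgt tgt.
split; first by rewrite (le_trans sT0 (ltW tgt)) ge_min lexx.
move=> s /andP[s0 st]; have [sT|Ts] := leP s (sup T).
  by apply: TsT.2; rewrite s0.
apply: rB; rewrite /ball /= distrC ger0_norm ?subr_ge0 ?(ltW Ts) //.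
rewrite ltrBlDl; apply: le_lt_trans st _; rewrite gt_min; apply/orP; right.
by rewrite ltrD2l ltr_pdivrMr // ltr_pMr // ltr1n.
Qed.

End SlowCurves.

Section Equicontinuity.
Context (R : realType).

(** Equicontinuity at [q] of all maps that preserve the metric, stated without a
    distance. The coordinate segment from [p] to [q] is short when [p] is close
    to [q], uniformly in [f] its image is a curve of small metric speed starting
    at [P], and such a curve stays in a small chart ball around [P]. *)
Lemma isometric_equicontinuity (N M : riemannian_manifold R) (P : M) (V : set M)
    (q : N) : open V -> V P ->
  \forall p \near q, forall f : N -> M, smooth_map f ->
    is_pullback (@metric R N) (@metric R M) f -> f p = P -> V (f q).
Proof.
move=> Vo VP.
have [j jP] := @atlas_cover _ _ M P.
have [e eq] := @atlas_cover _ _ N q.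
pose u0 := chart_map (atlas j) P; pose uq := chart_map (atlas e) q.
have iu0 : chart_img (atlas j) u0 by exact: chart_map_img.
have iuq : chart_img (atlas e) uq by exact: chart_map_img.
have [m [m0 near_m]] := metric_lower iu0.
have [C [C0 near_C]] := metric_upper iuq.
have near_V : \forall u \near u0, V (chart_inv (atlas j) u).
  apply: (chart_inv_continuous iu0); rewrite chart_mapK //.
  exact: open_nbhs_nbhs.
have [d /= d0 dB] := (nbhs_normP _ _).1 (filterI near_m near_V).
have [r /= r0 rB] := (nbhs_normP _ _).1 near_C.
pose eps := d / 2.
have eps0 : 0 < eps by exact: divr_gt0.
(* [k <= 1] and [C * k <= m] give [C * (eps * k) ^+ 2 <= m * eps ^+ 2], the
   speed bound wanted in [slow_curve_stays] for a segment of length [eps * k] *)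
pose k := Num.min 1 (m / C).
have k0 : 0 < k by rewrite lt_min ltr01 divr_gt0.
have near_p : \forall p \near q, chart_dom (atlas e) p /\
    `|uq - chart_map (atlas e) p| < Num.min r (eps * k).
  apply: filterI.
    by apply: open_nbhs_nbhs; split=> //; exact: chart_dom_open.
  have := @chart_map_continuous _ _ _ _ q eq.
  move=> /cvgrPdist_lt; apply.
  by rewrite lt_min r0 mulr_gt0.
apply: filterS near_p => p [ep]; rewrite lt_min => /andP[pr pk] f sf pf fpP.
pose up := chart_map (atlas e) p; pose w := uq - up.
pose line (t : R) := up + t *: w.
have line_ball (t : R) : 0 <= t <= 1 -> `|uq - line t| < r.
  move=> /andP[t0 t1]; rewrite /line opprD addrA -/w -[w in w - _]scale1r.
  rewrite -scalerBl normrZ ger0_norm ?subr_ge0 //.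
  by apply: le_lt_trans pr; rewrite ler_piMl // lerBlDl lerDr.
have Bline (t : R) : 0 <= t <= 1 -> chart_img (atlas e) (line t) /\
    inner (metric e (line t)) w w <= C * `|w| ^+ 2.
  by move=> /line_ball lt; have [i1 i2] := rB (line t) lt; split.
pose c (t : R) : M := f (chart_inv (atlas e) (line t)).
have line0 : line 0 = up by rewrite /line scale0r addr0.
have line1 : line 1 = uq by rewrite /line scale1r addrC subrK.
have c0 : c 0 = P by rewrite /c line0 chart_mapK.
have c1 : c 1 = f q by rewrite /c line1 chart_mapK.
have lineC : continuous line.
  move=> t; apply: cvgD; first exact: cvg_cst.
  by apply: cvgZr_tmp; exact: cvg_id.
have [||||t t01||jc1 lt1] := @slow_curve_stays R M j c m d eps.
- by rewrite c0.
- exact: m0.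
- by rewrite (ltW eps0) /eps ltr_pdivrMr // ltr_pMr // ltr1n.
- move=> u; rewrite /= c0 => ud.
  by have [] := dB u ud.
- have [il _] := Bline t t01.
  apply: (@continuous_comp _ _ _ (fun t => chart_inv (atlas e) (line t)) f).
    by apply: continuous_comp; [exact: lineC|exact: chart_inv_continuous].
  exact: sf.1.
- move=> t t01 jct; have [il leC] := Bline t t01.
  have ld : local_dom (atlas e) (atlas j) f (line t) by [].
  have dl := smooth_on_differentiable (smooth_map_on e j sf) ld.
  have [D1 D2] := is_derive_line dl.
  split; first exact: D1.
  rewrite [X in inner _ X _]D2 [X in inner _ _ X]D2.
  rewrite -[X in metric j X]/(local_rep (atlas e) (atlas j) f (line t)).
  rewrite -(pf e j _ ld); apply: le_trans leC _.
  have wk : `|w| ^+ 2 <= eps ^+ 2 * k ^+ 2.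
    have ek : 0 <= eps * k by apply: mulr_ge0; exact: ltW.
    by rewrite -exprMn; apply: lerXn2r; [exact: normr_ge0|exact: ek|exact: ltW pk].
  have kC : C * k ^+ 2 <= m.
    have k1 : k <= 1 by rewrite ge_min lexx.
    have kmC : k <= m / C by rewrite ge_min lexx orbT.
    rewrite expr2 mulrA; apply: le_trans (_ : C * k <= _).
      by apply: ler_piMr k1; apply: mulr_ge0; exact: ltW.
    by rewrite mulrC -ler_pdivlMr.
  apply: le_trans (ler_wpM2l (ltW C0) wk) _.
  rewrite mulrCA [leRHS]mulrC; apply: ler_wpM2l kC.
  exact: exprn_ge0 (ltW eps0).
rewrite /= c0 in lt1; have [_] := dB _ lt1.
by rewrite chart_mapK // c1.
Qed.

End Equicontinuity.

(** * Countable covers and the Baire property *)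

Section Countability.

Lemma countable_enum T (B : set (set T)) : countable B ->
  exists e : nat -> set T, forall U, B U -> exists n, e n = U.
Proof.
move=> /pcard_leP[f].
exists (fun n => xget set0 [set U | B U /\ f U = n]) => U BU.
exists (f U).
have [B' fE] := @xgetPex _ set0 [set U' | B U' /\ f U' = f U]
  (ex_intro _ U (conj BU erefl)).
by apply: (@inj _ _ _ f) fE; rewrite inE.
Qed.

Lemma countable_representatives T U (c : T -> set U) : T ->
  countable (range c) -> exists r : nat -> T, forall p, exists n, c (r n) = c p.
Proof.
move=> t0 /countable_enum[e eP].
have rP n : exists p, (exists p', c p' = e n) -> c p = e n.
  by have [[p cp]|no] := pselect (exists p', c p' = e n); [exists p|exists t0].
exists (fun n => sval (cid (rP n))) => p.
have [n en] := eP (c p) (ex_intro2 _ _ p I erefl).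
exists n; case: cid => q /= qP; rewrite qP //; exists p.
by rewrite en.
Qed.

(** Enumerate a countable basis and enlarge to a compact set each basic open set
    for which this is possible; by local compactness every point lies in such a
    basic set. *)
Lemma sigma_compact (T : topologicalType) :
  @second_countable T -> (forall x : T, exists2 K, compact K & nbhs x K) ->
  exists K : nat -> set T, (forall n, compact (K n)) /\
    forall x, exists n, K n x.
Proof.
move=> [B /countable_enum[e eB] [_ Bbase]] lc.
have KP n : exists K : set T, compact K /\
    ((exists2 K', compact K' & e n `<=` K') -> e n `<=` K).
  have [[K' cK' eK']|no] := pselect (exists2 K', compact K' & e n `<=` K').
    by exists K'.
  by exists set0; split=> //; exact: compact0.
exists (fun n => sval (cid (KP n))); split=> [n|x].
  by case: cid => K /= [].
have [K cK xK] := lc x; have [U [BU Ux] UK] := Bbase x K xK.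
have [n en] := eB U BU; exists n; case: cid => K' /= [_ +].
by rewrite en; apply=> //; exists K.
Qed.

End Countability.

Section RowBaire.
Context (R : realType) (n : nat).

HB.instance Definition _ := Complete.on 'rV[R]_n.

Lemma row_Baire (F : nat -> set 'rV[R]_n) :
  (forall i, open (F i) /\ dense (F i)) -> dense (\bigcap_i F i).
Proof. exact: Baire. Qed.

End RowBaire.

Section ManifoldTopology.
Context (R : realType).

Lemma chart_ball (N : manifold R) (i : atlas_index N) (x : N) :
  chart_dom (atlas i) x -> exists2 r : R, 0 < r &
    forall u, `|chart_map (atlas i) x - u| <= r -> chart_img (atlas i) u.
Proof.
move=> ix.
have : nbhs (chart_map (atlas i) x) (chart_img (atlas i)).
  apply: open_nbhs_nbhs; split; first exact: chart_img_open.
  exact: chart_map_img.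
move=> /(nbhs_normP _ _).1[r /= r0 rB].
exists (r / 2); first exact: divr_gt0.
move=> u ur; apply: rB; apply: le_lt_trans ur _.
by rewrite ltr_pdivrMr // ltr_pMr // ltr1n.
Qed.

Lemma manifold_locally_compact (N : manifold R) (x : N) :
  exists2 K, compact K & nbhs x K.
Proof.
have [i ix] := @atlas_cover _ _ N x; have [r r0 rB] := chart_ball ix.
exists (chart_inv (atlas i) @` [set u | `|chart_map (atlas i) x - u| <= r]).
  exact: chart_ball_compact.
have nx : \forall y \near x, chart_dom (atlas i) y.
  by apply: open_nbhs_nbhs; split=> //; exact: chart_dom_open.
have cx := @chart_map_continuous _ _ _ (atlas i) x ix.
move/cvgrPdist_lt : cx => /(_ _ r0) cx.
apply: filterS2 nx cx => y iy xy.
by exists (chart_map (atlas i) y); [exact: ltW|exact: chart_mapK].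
Qed.

(** The sets are transported to a closed coordinate ball, where Baire's theorem
    for the complete space of row vectors applies; an open set of coordinates is
    carried back by the chart. *)
Lemma manifold_Baire (N : manifold R) (x : N) (F : nat -> set N) :
  (forall n, closed (F n)) -> (forall y, exists n, F n y) ->
  exists n (y : N), nbhs y (F n).
Proof.
move=> Fc Fcov.
have [i ix] := @atlas_cover _ _ N x; have [r r0 rB] := chart_ball ix.
pose u0 := chart_map (atlas i) x.
pose D n := [set u | `|u0 - u| <= r /\ F n (chart_inv (atlas i) u)].
have Do n : open (~` D n).
  rewrite openE => u nDu.
  have [ur|ru] := leP `|u0 - u| r.
    have nFu : ~ F n (chart_inv (atlas i) u) by move=> Fu; apply: nDu.
    have := chart_inv_continuous (rB u ur).
    move=> /(_ (~` F n)) near_nF.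
    have : nbhs u (chart_inv (atlas i) @^-1` (~` F n)).
      by apply: near_nF; apply: open_nbhs_nbhs; split=> //; exact: closed_openC.
    by apply: filterS => v nFv [_ Fv].
  have : open (~` closed_ball_ Num.Def.normr u0 r).
    by apply: closed_openC; exact: closed_closed_ball_.
  rewrite openE => /(_ u); rewrite /closed_ball_ /= => H.
  have : nbhs u (~` closed_ball_ Num.Def.normr u0 r).
    by apply: H; apply/negP; rewrite -ltNge.
  by apply: filterS => v nv [vr _]; exact: nv.
have [n nD] : exists n, ~ dense (~` D n).
  apply: contrapT => /forallNP allD.
  have dD : dense (\bigcap_n ~` D n).
    by apply: row_Baire => n; split; [exact: Do|exact: contrapT (allD n)].
  have := dD (ball u0 r) (ex_intro _ u0 (ballxx _ r0)) (ball_open _ _).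
  move=> [u []]; rewrite -ball_normE /= => ur uD.
  have [n Fn] := Fcov (chart_inv (atlas i) u).
  by apply: (uD n) => //; split=> //; exact: ltW.
have [W [[u Wu] [Wo WDn]]] : exists W : set 'rV[R]_(mdim N),
    W !=set0 /\ open W /\ W `<=` D n.
  apply: contrapT => no; apply: nD => W W0 Wo; apply: contrapT => WD.
  apply: no; exists W; split=> //; split=> // v Ov.
  by apply: contrapT => nDv; apply: WD; exists v.
exists n, (chart_inv (atlas i) u).
have iu : chart_img (atlas i) u by apply: rB; have [] := WDn u Wu.
have iy := chart_inv_dom iu.
have ny : \forall y \near chart_inv (atlas i) u, chart_dom (atlas i) y.
  by apply: open_nbhs_nbhs; split=> //; exact: chart_dom_open.
have Wy : \forall y \near chart_inv (atlas i) u, W (chart_map (atlas i) y).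
  apply: (chart_map_continuous iy); rewrite chart_invK //.
  exact: open_nbhs_nbhs.
apply: filterS2 ny Wy => y iy' /WDn[_]; by rewrite chart_mapK.
Qed.

End ManifoldTopology.

(** * Embedded submanifolds are locally closed *)

Section Embedded.
Context (R : realType) (M : riemannian_manifold R) (S : submanifold M).
Let incl : S -> M := @sub_incl R M S.

Lemma sub_incl_continuous : continuous incl.
Proof. by have [[]] := @sub_incl_immersion R M S. Qed.

Lemma embedded_open (U : set S) : embedded S -> open U ->
  exists2 V : set M, open V & forall s, U s <-> V (incl s).
Proof.
move=> emb /emb[V Vo UV]; exists V => // s; split=> [Us|Vs].
  have : (incl @` U) (incl s) by exists s.
  by rewrite UV => -[].
have : (V `&` sub_points S) (incl s) by split=> //; exists s.
by rewrite -UV => -[t Ut] /(@sub_incl_inj R M S) <-.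
Qed.

(** An embedded submanifold is locally closed: a compact neighbourhood in [S] of
    a point of [S] has a closed image, and it contains the trace of [S] on an
    open set of [M], on which the closure of [S] therefore adds nothing. *)
Lemma embedded_frontier_closed : embedded S ->
  closed (closure (sub_points S) `\` sub_points S).
Proof.
move=> emb x clx; split.
  apply: closed_closure; apply: closureS clx; exact: subDsetl.
move=> [s _ sx].
have [K cK sK] := manifold_locally_compact s.
have Kcl : closed (incl @` K).
  apply: compact_closed; first exact: (smooth_hausdorff M).
  apply: continuous_compact => //; apply: continuous_subspaceT.
  exact: sub_incl_continuous.
have [V Vo VK] := embedded_open emb (open_interior K).
have Vx : V x by rewrite -sx; apply/VK.
have [y [[cly nSy] Vy]] := clx V (open_nbhs_nbhs (conj Vo Vx)).
apply: nSy.
suff [t _ <-] : (incl @` K) y by exists t.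
apply: Kcl => W yW.
have [z [[t _ tz] [Wz Vz]]] := cly _ (filterI yW (open_nbhs_nbhs (conj Vo Vy))).
exists z; split=> //; exists t => //.
by apply: interior_subset; apply/VK; rewrite /incl tz.
Qed.

End Embedded.

(** * Stabilizers in the group *)

Section Stabilizers.
Context (R : realType) (M : riemannian_manifold R) (G : lie_group R).
Context (a : isometric_action G M).

Lemma act_continuous g : continuous (a g).
Proof. by have [] := act_smooth_map a g. Qed.

Lemma orbit_map_continuous x : continuous (fun g => a g x).
Proof.
move=> g; have [ac _] := act_smooth a.
apply: (@continuous_comp _ _ _ (fun g : G => (g, x)) (fun z : G * M => a z.1 z.2)).
  by apply: cvg_pair; [exact: cvg_id|exact: cvg_cst].
exact: ac.
Qed.

Lemma inv_continuous : continuous (fun g : G => g^-1%g).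
Proof. by have [] := lie_inv_smooth G. Qed.

Definition stabilizer (A : set M) : set G := [set g | forall x, A (a g x) <-> A x].

Lemma stabilizerP (A : set M) g : stabilizer A g <-> a g @` A = A.
Proof.
split=> [gA|gA x].
  apply/seteqP; split=> [_ [x Ax <-]|y Ay]; first exact/gA.
  by exists (a g^-1%g y); [apply/gA; rewrite actKV|rewrite actKV].
split=> [|Ax]; last by rewrite -gA; exists x.
by rewrite -{1}gA => -[y Ay] /(can_inj (actK a g)) <-.
Qed.

Lemma stabilizerV A g : stabilizer A g -> stabilizer A g^-1%g.
Proof. by move=> gA x; rewrite -gA actKV. Qed.

Lemma stabilizerM A g h : stabilizer A g -> stabilizer A h ->
  stabilizer A (g * h)%g.
Proof. by move=> gA hA x; rewrite actM gA hA. Qed.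

Lemma closed_preserving (F : set M) : closed F ->
  closed [set g | forall x, F x -> F (a g x)].
Proof.
move=> Fc g clg x Fx; apply: Fc => V gV.
have [h [hF hV]] := clg _ (orbit_map_continuous gV).
by exists (a h x); split=> //; exact: hF.
Qed.

Lemma stabilizer_closure A g : stabilizer A g -> stabilizer (closure A) g.
Proof.
have sub h : stabilizer A h -> forall x, closure A x -> closure A (a h x).
  move=> hA x clx V /(act_continuous (g := h)) xV.
  by have [y [Ay Vy]] := clx _ xV; exists (a h y); split=> //; apply/hA.
move=> gA x; split=> [|]; last exact: sub.
by move=> /(sub _ (stabilizerV gA)); rewrite actK.
Qed.

(** A group element stabilizes [A] exactly when it and its inverse preserve the
    closure of [A] and the frontier [closure A `\` A]. Both sets being closed,
    these are closed conditions on the group element. *)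
Lemma stabilizer_closed (A : set M) : closed (closure A `\` A) ->
  closed (stabilizer A).
Proof.
set B := _ `\` _ => Bc.
pose P (F : set M) : set G := [set g | forall x, F x -> F (a g x)].
have -> : stabilizer A = P (closure A) `&` P B `&`
    (fun g : G => g^-1%g) @^-1` (P (closure A) `&` P B).
  apply/seteqP; split=> [g gA|g [[g1 g2] [g3 g4]] x].
    have half h : stabilizer A h -> (P (closure A) `&` P B) h.
      move=> hA; have hC := stabilizer_closure hA.
      split=> [x /hC//|x [Cx nAx]]; split; first exact/hC.
      by move/hA.
    by split; [exact: half|apply: half; exact: stabilizerV].
  split=> [Agx|Ax].
    have Cx : closure A x.
      by rewrite -(actK a g x); apply: g3; exact: subset_closure.
    apply: contrapT => nAx; have [_] := g2 x (conj Cx nAx); exact.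
  have Cgx : closure A (a g x) by apply: g1; exact: subset_closure.
  apply: contrapT => nAgx; have [_] := g4 _ (conj Cgx nAgx).
  by rewrite actK.
have Pc : closed (P (closure A) `&` P B).
  by apply: closedI; apply: closed_preserving => //; exact: closed_closure.
apply: closedI => //; apply: closed_comp => // g _; exact: inv_continuous.
Qed.

End Stabilizers.

(** * Orbits of the stabilizer on the submanifold *)

Section Orbits.
Context (R : realType) (M : riemannian_manifold R) (G : lie_group R).
Context (a : isometric_action G M) (S : submanifold M).
Let incl : S -> M := @sub_incl R M S.
Let A : set M := sub_points S.

Definition same_orbit (s t : S) : Prop :=
  exists2 h, stabilizer a A h & a h (incl s) = incl t.

Lemma same_orbit_refl s : same_orbit s s.
Proof. by exists 1%g => [x|]; rewrite act1. Qed.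

Lemma same_orbit_sym s t : same_orbit s t -> same_orbit t s.
Proof.
by move=> [h hA ht]; exists h^-1%g; [exact: stabilizerV|rewrite -ht actK].
Qed.

Lemma same_orbit_trans s t u : same_orbit s t -> same_orbit t u -> same_orbit s u.
Proof.
move=> [h hA ht] [k kA ku].
by exists (k * h)%g; [exact: stabilizerM|rewrite actM ht].
Qed.

Lemma stabilizer_orbit h s : stabilizer a A h ->
  exists2 t, incl t = a h (incl s) & same_orbit s t.
Proof.
move=> hA; have [t _ ts] : A (a h (incl s)) by apply/hA; exists s.
by exists t => //; exists h.
Qed.

(** The stabilizer acts on [S] by homeomorphisms, since [S] carries the subspace
    topology, and moves an interior point of the orbit to any other point. *)
Lemma orbit_open (p s : S) : embedded S ->
  nbhs s [set t | same_orbit p t] -> open [set t | same_orbit p t].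
Proof.
move=> emb ps; rewrite openE => t pt.
have [V Vo VE] := embedded_open emb (open_interior [set t | same_orbit p t]).
have [h hA ht] : same_orbit s t.
  by apply: same_orbit_trans pt; apply: same_orbit_sym; exact: nbhs_singleton ps.
have Vs : V (a h^-1%g (incl t)) by rewrite -ht actK; exact/VE.
have cont : continuous (a h^-1%g \o incl).
  move=> r; apply: continuous_comp; first exact: sub_incl_continuous.
  exact: act_continuous.
have near_t : \forall r \near t, V ((a h^-1%g \o incl) r).
  by apply: cont; apply: open_nbhs_nbhs.
apply: filterS near_t => r Vr.
have [r' r'E rr'] := stabilizer_orbit r (stabilizerV hA).
apply: (same_orbit_trans (t := r')); last exact: same_orbit_sym.
by apply: (@interior_subset _ [set t | same_orbit p t]); apply/VE;
  rewrite -/(incl r') r'E.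
Qed.

(** Let [q] be adherent to the orbit of [p]. Some [h] in the stabilizer carries
    [p] to a point [r] as close to [q] as desired, and by equicontinuity [h^-1],
    which carries [r] to [p], carries [q] near [p], hence into the open
    orbit. *)
Lemma open_orbit_closed (p : S) : embedded S ->
  open [set t | same_orbit p t] -> closed [set t | same_orbit p t].
Proof.
move=> emb po q clq.
have [V Vo VE] := embedded_open emb po.
have Vp : V (incl p) by apply/VE; exact: same_orbit_refl.
have nq := isometric_equicontinuity q Vo Vp.
have [r [[h hA hr] fr]] := clq _ nq.
have Vq : V (a h^-1%g (incl q)).
  apply: (fr (a h^-1%g \o incl)); last by rewrite /= -hr actK.
    exact: translate_smooth.
  exact: translate_pullback.
have [q' q'E qq'] := stabilizer_orbit q (stabilizerV hA).
apply: (same_orbit_trans (t := q')); last exact: same_orbit_sym.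
by apply/VE; rewrite -/(incl q') q'E.
Qed.

(** The stabilizer is closed in a sigma-compact group, so each orbit is a
    countable union of continuous images of compact sets, which are closed.
    Countably many orbits cover [S], and Baire's theorem gives interior to one of
    these pieces. *)
Lemma orbit_with_interior (r : nat -> S) : embedded S ->
  (forall s, exists n, same_orbit (r n) s) ->
  exists n (s : S), nbhs s [set t | same_orbit (r n) t].
Proof.
move=> emb rcov.
have [K [cK Kcov]] := sigma_compact (smooth_second_countable (lie_manifold G))
  (@manifold_locally_compact R (lie_manifold G)).
have Hc : closed (stabilizer a A : set G).
  by apply: stabilizer_closed; exact: embedded_frontier_closed.
pose F (n m : nat) := [set t | exists2 h, (K m `&` stabilizer a A) h &
  a h (incl (r n)) = incl t].
have Fc n m : closed (F n m).
  have cKH : compact (K m `&` stabilizer a A) by exact: compact_closedI.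
  have -> : F n m = incl @^-1` ((fun h => a h (incl (r n))) @` (K m `&` stabilizer a A)).
    by apply/seteqP; split=> [t [h hK ht]|t [h hK ht]]; exists h.
  apply: closed_comp; first by move=> t _; exact: sub_incl_continuous.
  apply: compact_closed; first exact: (smooth_hausdorff M).
  apply: continuous_compact => //; apply: continuous_subspaceT.
  exact: orbit_map_continuous.
(* the double sequence [F] in one index *)
pose F' k := if unpickle k is Some nm then F nm.1 nm.2 else set0.
have [|s|k [s sF]] := @manifold_Baire R S (r 0) F'.
- by move=> k; rewrite /F'; case: unpickle => [[n m]|]; [exact: Fc|exact: closed0].
- have [n [h hA hs]] := rcov s; have [m hK] := Kcov h.
  by exists (pickle (n, m)); rewrite /F' pickleK; exists h.
move: sF; rewrite /F'; case: unpickle => [[n m] sF|/nbhs_singleton//].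
exists n, s; apply: filterS sF => t [h [_ hA] ht].
by exists h.
Qed.

(** An orbit with interior is open and closed, and [S] is connected. *)
Lemma countable_orbits_transitive (r : nat -> S) :
  embedded S -> connected [set: S] ->
  (forall s, exists n, same_orbit (r n) s) -> forall s t, same_orbit s t.
Proof.
move=> emb con rcov.
have [n [p np]] := orbit_with_interior emb rcov.
have po := orbit_open emb np.
have all_p : [set t | same_orbit (r n) t] = setT.
  apply: con.
  - by exists (r n); exact: same_orbit_refl.
  - by exists [set t | same_orbit (r n) t]; rewrite ?setTI.
  - exists [set t | same_orbit (r n) t]; rewrite ?setTI //.
    exact: open_orbit_closed.
have allE s : same_orbit (r n) s.
  by rewrite -[same_orbit _ _]/([set t | same_orbit (r n) t] s) all_p.
by move=> s t; apply: same_orbit_trans (allE t); exact: same_orbit_sym.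
Qed.

(** If [k] in the isotropy group carries one translate to the other, then
    [h^-1 * k * g] stabilizes [S] and carries [s] to [t]. *)
Lemma congruent_same_orbit (o : M) (g h : G) (s t : S) :
  a g (incl s) = o -> a h (incl t) = o ->
  isotropy_congruent a o (a g @` A) (a h @` A) -> same_orbit s t.
Proof.
move=> gs ht [k ko kA].
exists (h^-1 * (k * g))%g; last by rewrite !actM gs ko -ht actK.
apply/stabilizerP.
have -> : a (h^-1 * (k * g))%g @` A = a h^-1%g @` (a k @` (a g @` A)).
  by rewrite !image_comp; congr (_ @` _); apply/funext => x; rewrite /= !actM.
rewrite kA image_comp; apply/seteqP; split=> [_ [x Ax <-]|x Ax].
  by rewrite /= actK.
by exists x => //=; rewrite actK.
Qed.

(** Every point of [S] is moved to [o] by some group element, and the translate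
    of [S] by that element represents one of the given classes; by
    [congruent_same_orbit] the class determines the orbit of the point. *)
Lemma classes_countable_orbits (o : M) (S0 : submanifold M) :
  S -> transitive_action a -> complete_riemannian S -> totally_geodesic S ->
  isometric S S0 -> countable (isotropy_congruence_classes a o S0) ->
  exists r : nat -> S, forall s, exists n, same_orbit (r n) s.
Proof.
move=> s0 tr cS tgS iS cnt.
have [g gP] : exists g : S -> G, forall s, a (g s) (incl s) = o.
  exists (fun s => sval (cid (tr (incl s) o))) => s.
  exact: svalP (cid (tr (incl s) o)).
pose c (s : S) : set (set M) := [set B | geodesic_submanifolds_at o S0 B /\
  isotropy_congruent a o (a (g s) @` A) B].
have at_o s : geodesic_submanifolds_at o S0 (a (g s) @` A).
  exists (translate a (g s) S); split=> //.
  - exact: translate_totally_geodesic.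
  - exact: sub_points_translate.
  - by rewrite -(gP s); exists (incl s) => //; exists s.
have cc : countable (range c).
  apply: sub_countable cnt; apply: subset_card_le => _ [s _ <-].
  by exists (a (g s) @` A).
have [r rP] := countable_representatives s0 cc.
exists r => s; have [n rs] := rP s; exists n.
apply: congruent_same_orbit (gP (r n)) (gP s) _.
suff : c (r n) (a (g s) @` A) by case.
rewrite rs; split=> //; exists 1%g; first exact: act1.
by apply/seteqP; split=> [_ [x Ax <-]|x Ax]; [rewrite act1|exists x; rewrite ?act1].
Qed.

End Orbits.

Theorem lemma3p4 (R : realType) (M : riemannian_manifold R) (G : lie_group R)
    (a : isometric_action G M) (o : M) (S : submanifold M) :
  transitive_action a ->
  complete_riemannian S -> totally_geodesic S -> sub_points S o ->
  finite_set (isotropy_congruence_classes a o S) ->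
  forall S' : submanifold M,
    complete_riemannian S' -> embedded S' -> totally_geodesic S' ->
    isometric S' S ->
    extrinsically_homogeneous a S'.
Proof.
move=> tr _ _ _ fin S' cS' emb tgS' iS' _ _ [s _ <-] [t _ <-].
have [r rP] := classes_countable_orbits s tr cS' tgS' iS'
  (finite_set_countable fin).
have [h hA hst] := countable_orbits_transitive emb tgS'.1 rP s t.
by exists h => //; apply/stabilizerP.
Qed.
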